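(* Let $(\mathbf{X}_n)_{n\in\mathbb{Z}_+}$ be an inhomogeneous $d$-type Galton--Watson process with immigration (GWI process) with Bernoulli offspring distributions, immigration mean vectors $\mathbf{m}_n$ and immigration generating functions $H_n$. Assume that the offspring mean matrices have the form $$\mathbf{B}_n=\varrho_n\mathbf{B},\qquad n\in\mathbb{N},$$ where $\mathbf{B}$ is an invertible substochastic matrix, and $\varrho_n<1$, $\varrho_n\to1$, $\sum_{n=1}^\infty(1-\varrho_n)=\infty$ and $(1-\varrho_n)/(1-\varrho_{n+1})\to1$. Moreover, assume that for some $k\ge2$ $$\lim_{n\to\infty}\frac{\max_{|\boldsymbol{j}|=k}D^{\boldsymbol{j}}H_n(\mathbf{1})}{1-\varrho_n}=0,\qquad \lim_{n\to\infty}\frac{\mathbf{m}_n}{1-\varrho_n}=\boldsymbol{\lambda},$$ and that for each $i=2,\dots,k-1$ and each $1\le\ell_{i+1},\dots,\ell_{2i}\le d$ the limit $$\lim_{n\to\infty}\sum_{j=1}^n\frac{(\varrho_{[j,n]})^i}{i!}\sum_{\ell_1,\dots,\ell_i=1}^d\frac{\partial^iH_j(\mathbf{1})}{\partial x_{\ell_1}\cdots\partial x_{\ell_i}}\left(\mathbf{B}^{n-j}\right)_{\ell_1,\ell_{i+1}}\cdots\left(\mathbf{B}^{n-j}\right)_{\ell_i,\ell_{2i}}=:\Lambda_{i;\ell_{i+1},\dots,\ell_{2i}}$$ exists. Then $$\mathbf{X}_n\stackrel{\mathcal{D}}{\longrightarrow}\mathbf{Y}\qquad(n\to\infty),$$ where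 $\mathbf{Y}$ is a random vector with generating function, for $\mathbf{x}\in[0,1]^d$, $$\mathsf{E}\,\mathbf{x}^{\mathbf{Y}}=\exp\left\{(\mathbf{x}-\mathbf{1})(\boldsymbol{\lambda}\mathbf{A})^\top+\sum_{i=2}^{k-1}\sum_{\ell_{i+1},\dots,\ell_{2i}=1}^d\Lambda_{i;\ell_{i+1},\dots,\ell_{2i}}(x_{\ell_{i+1}}-1)\cdots(x_{\ell_{2i}}-1)\right\},$$ and $\mathbf{A}$ is the matrix $\mathbf{A}=\lim_{n\to\infty}\sum_{k=1}^n\varrho_{[k,n]}(1-\varrho_k)\mathbf{B}^{n-k}$ (this limit exists under the assumptions on $\mathbf{B}$ and $(\varrho_n)$).
   Context: Elements of $\mathbb{R}^d$ are row vectors; $\mathbf{e}_1,\dots,\mathbf{e}_d$ is the standard basis and $\mathbf{1}=(1,\dots,1)$. $(\mathbf{A})_{k,\ell}$ is the $(k,\ell)$ entry of $\mathbf{A}$. A substochastic matrix has nonnegative entries and row sums at most $1$. Inhomogeneous $d$-type GWI process: $\mathbf{X}_0=\mathbf{0}$ and $\mathbf{X}_n=\sum_{i=1}^d\sum_{j=1}^{X_{n-1,i}}\boldsymbol{\xi}_{n,j,i}+\boldsymbol{\varepsilon}_n$ for $n\in\mathbb{N}=\{1,2,\dots\}$, where $\mathbf{X}_n=(X_{n,1},\dots,X_{n,d})$ and $\{\boldsymbol{\xi}_{n,j,i},\boldsymbol{\varepsilon}_n: n,j\in\mathbb{N},\,1\le i\le d\}$ are independent random vectors with values in $\mathbb{Z}_+^d$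 such that for each $n,i$ the vectors $\boldsymbol{\xi}_{n,j,i}$, $j\in\mathbb{N}$, are identically distributed. All offspring and immigration means are finite. The offspring mean matrix $\mathbf{B}_n\in\mathbb{R}_+^{d\times d}$ is the matrix whose $i$-th row is $\mathsf{E}\boldsymbol{\xi}_{n,1,i}$, and $\mathbf{m}_n=\mathsf{E}\boldsymbol{\varepsilon}_n$. $\varrho_{[j,n]}=\varrho_{j+1}\varrho_{j+2}\cdots\varrho_n$ for $0\le j\le n-1$, and $\varrho_{[n,n]}=1$. For $\mathbf{p}=(p_1,\dots,p_d)\in[0,1]^d$ with $p_1+\dots+p_d\le1$, $\mathrm{Be}(\mathbf{p})$ is the distribution on $\{\mathbf{0},\mathbf{e}_1,\dots,\mathbf{e}_d\}$ giving mass $p_i$ to $\mathbf{e}_i$ and $1-\sum_ip_i$ to $\mathbf{0}$. ''Bernoulli offspring distributions'' means that $\boldsymbol{\xi}_{n,1,i}$ has law $\mathrm{Be}(\mathbf{e}_i\mathbf{B}_n)$ for all $n,i$. $\mathbf{x}^{\mathbf{k}}=x_1^{k_1}\cdots x_d^{k_d}$ and $H_n(\mathbf{x})=\mathsf{E}\,\mathbf{x}^{\boldsymbol{\varepsilon}_n}$, $\mathbf{x}\in[0,1]^d$. For a multi-index $\boldsymbol{j}=(j_1,\dots,j_d)\in\mathbb{Z}_+^d$, $|\boldsymbol{j}|=j_1+\dots+j_d$ and $D^{\boldsymbol{j}}H_n(\mathbf{1})=\frac{\partial^{|\boldsymbol{j}|}H_n}{\partial x_1^{j_1}\cdots\partial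 x_d^{j_d}}(\mathbf{1})$; derivatives at $\mathbf{1}$ are left derivatives, so that $D^{\boldsymbol{j}}H_n(\mathbf{1})=\mathsf{E}\prod_{i=1}^d\varepsilon_{n,i}(\varepsilon_{n,i}-1)\cdots(\varepsilon_{n,i}-j_i+1)$. $\stackrel{\mathcal{D}}{\longrightarrow}$ is convergence in distribution. *)

(* Defs.v *)
From HB Require Import structures.
From mathcomp Require Import all_boot all_order all_algebra.
From mathcomp Require Import all_classical all_reals all_analysis.
Set Implicit Arguments. Unset Strict Implicit. Unset Printing Implicit Defensive.
Import Order.TTheory GRing.Theory Num.Theory.
Import numFieldNormedType.Exports.
Local Open Scope classical_set_scope.
Local Open Scope ring_scope.

(* Vectors of natural numbers carry the discrete sigma-algebra, so that
   [{RV P >-> 'rV[nat]_d}] is the type of Z_+^d-valued random vectors. *)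
HB.instance Definition _ (m n : nat) := @isMeasurable.Build
  default_measure_display 'M[nat]_(m, n) discrete_measurable
  discrete_measurable0 discrete_measurableC discrete_measurableU.

Definition substochastic (R : realType) (d : nat) (B : 'M[R]_d) : Prop :=
  (forall i j, 0 <= B i j) /\ (forall i, \sum_j B i j <= 1).

Section RandomVectors.
Context (disp : measure_display) (Omega : measurableType disp) (R : realType).
Variable P : probability Omega R.

Definition finite_mean (d : nat) (V : Omega -> 'rV[nat]_d) : Prop :=
  forall l, ('E_P[fun w => (V w ord0 l)%:R] < +oo)%E.

Definition mean (d : nat) (V : Omega -> 'rV[nat]_d) : 'rV[R]_d :=
  \row_l fine 'E_P[fun w => (V w ord0 l)%:R].

(* The value is a priori in [\bar R] (it is finite on [0,1]^d). *)
Definition pgf (d : nat) (V : Omega -> 'rV[nat]_d) (x : 'rV[R]_d) : \bar R :=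
  'E_P[fun w => \prod_l x ord0 l ^+ V w ord0 l].

Definition mutually_independent (d : nat) (I : eqType) (D : pred I)
    (V : I -> Omega -> 'rV[nat]_d) : Prop :=
  forall (J : seq I), uniq J -> {subset J <= D} ->
  forall A : I -> set 'rV[nat]_d,
    P (\bigcap_(t in [set` J]) V t @^-1` A t) =
    (\prod_(t <- J) P (V t @^-1` A t))%E.

Definition identically_distributed (d : nat) (V W : Omega -> 'rV[nat]_d) :=
  forall A : set 'rV[nat]_d, P (V @^-1` A) = P (W @^-1` A).

Definition Be (d : nat) (p : 'rV[R]_d) (A : set 'rV[nat]_d) : \bar R :=
  ((1 - \sum_i p ord0 i)%:E * \d_(0%R : 'rV[nat]_d) A +
   \sum_i (p ord0 i)%:E * \d_(delta_mx ord0 i : 'rV[nat]_d) A)%E.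

Definition has_Be_law (d : nat) (V : Omega -> 'rV[nat]_d) (p : 'rV[R]_d) :=
  forall A : set 'rV[nat]_d, P (V @^-1` A) = Be p A.

(* All data are indexed from 1: the values of [xi] and [eps] at index 0 are
   never used. The sum type indexes offspring and immigration jointly. *)
Definition gwi_family (d : nat)
    (xi : nat -> nat -> 'I_d -> {RV P >-> 'rV[nat]_d})
    (eps : nat -> {RV P >-> 'rV[nat]_d})
    (t : (nat * nat * 'I_d) + nat) : Omega -> 'rV[nat]_d :=
  match t with
  | inl (n, j, i) => xi n j i
  | inr n => eps n
  end.

Definition gwi_index (d : nat) (t : (nat * nat * 'I_d) + nat) : bool :=
  match t with
  | inl (n, j, i) => (0 < n)%N && (0 < j)%N
  | inr n => (0 < n)%N
  end.

Record is_gwi (d : nat)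
    (xi : nat -> nat -> 'I_d -> {RV P >-> 'rV[nat]_d})
    (eps : nat -> {RV P >-> 'rV[nat]_d})
    (X : nat -> Omega -> 'rV[nat]_d) : Prop := {
  gwi_indep : mutually_independent (@gwi_index d) (gwi_family xi eps);
  gwi_ident : forall n j i, (0 < n)%N -> (0 < j)%N ->
    identically_distributed (xi n j i) (xi n 1%N i);
  gwi_offspring_mean : forall n i, (0 < n)%N -> finite_mean (xi n 1%N i);
  gwi_immigration_mean : forall n, (0 < n)%N -> finite_mean (eps n);
  gwi_init : forall w, X 0%N w = 0;
  gwi_rec : forall n w, X n.+1 w =
    \sum_i \sum_(1 <= j < (X n w ord0 i).+1) xi n.+1 j i w + eps n.+1 w
}.

Definition offspring_mean_mx (d : nat)
    (xi : nat -> nat -> 'I_d -> {RV P >-> 'rV[nat]_d}) (n : nat) : 'M[R]_d :=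
  \matrix_i mean (xi n 1%N i).

Definition bernoulli_offspring (d : nat)
    (xi : nat -> nat -> 'I_d -> {RV P >-> 'rV[nat]_d}) : Prop :=
  forall n i, (0 < n)%N ->
    has_Be_law (xi n 1%N i) (row i (offspring_mean_mx xi n)).

End RandomVectors.

Definition rho_prod (R : realType) (rho : nat -> R) (j n : nat) : R :=
  \prod_(j.+1 <= s < n.+1) rho s.

(* Left partial derivative. It takes values in [\bar R] because the factorial
   moments of an immigration vector may be infinite. As [a - +oo = -oo] for all
   [a : \bar R] and [h < 0], the derivative is [+oo] wherever [f] is [+oo]. *)
Definition left_partial (R : realType) (d : nat) (l : 'I_d)
    (f : 'rV[R]_d -> \bar R) (x : 'rV[R]_d) : \bar R :=
  lim ((f (x + h *: delta_mx ord0 l)%R - f x) * (h^-1)%:E @[h --> 0^'-])%E.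

(* [iter_partial [:: l_1; ...; l_i] f] is
   d^i f / (d x_{l_1} ... d x_{l_i}). *)
Definition iter_partial (R : realType) (d : nat) (s : seq 'I_d)
    (f : 'rV[R]_d -> \bar R) : 'rV[R]_d -> \bar R :=
  foldr (@left_partial R d) f s.

(* D^j for a multi-index j. *)
Definition multi_partial (R : realType) (d : nat) (j : 'I_d -> nat)
    (f : 'rV[R]_d -> \bar R) : 'rV[R]_d -> \bar R :=
  iter_partial (flatten [seq nseq (j i) i | i <- enum 'I_d]) f.

(* Multi-indices with |j| = k have all their components in {0, ..., k}. *)
Definition max_partial (R : realType) (d k : nat)
    (f : 'rV[R]_d -> \bar R) (x : 'rV[R]_d) : \bar R :=
  \big[maxe/-oo%E]_(j : {ffun 'I_d -> 'I_k.+1} | (\sum_i j i == k)%N)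
    multi_partial (fun i => j i) f x.

Definition real_vec (R : realType) (d : nat) (v : 'rV[nat]_d) : 'rV[R]_d :=
  \row_l (v ord0 l)%:R.

Definition cvg_in_distribution (R : realType) (d : nat)
    (disp : measure_display) (Omega : measurableType disp)
    (P : probability Omega R) (X : nat -> Omega -> 'rV[R]_d)
    (disp' : measure_display) (Omega' : measurableType disp')
    (P' : probability Omega' R) (Y : Omega' -> 'rV[R]_d) : Prop :=
  forall f : 'rV[R]_d -> R,
    continuous f -> (exists M, forall x, `|f x| <= M) ->
    'E_P[f \o X n]%E @[n --> \oo] --> 'E_P'[f \o Y]%E.

(* Main.v *)
Require Import Defs.
From HB Require Import structures.
From mathcomp Require Import all_boot all_order all_algebra.
From mathcomp Require Import all_classical all_reals all_analysis.
From mathcomp Require Import measurable_realfun.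
From mathcomp Require Import ring lra.
Set Implicit Arguments. Unset Strict Implicit. Unset Printing Implicit Defensive.
Import Order.TTheory GRing.Theory Num.Theory.
Import numFieldNormedType.Exports.
Local Open Scope classical_set_scope.
Local Open Scope ring_scope.

(** Written in the variable [u = 1 - x], a Bernoulli offspring generating
function is affine: a parent of type [i] at time [n] contributes the factor
[1 - (rho n *: B u)_i]. Compositions of such maps stay affine, so conditioning on the
past one generation at a time gives the exact formula ([rpgf_gwi]), in which
[H_j] is the generating function of [eps j]:

  E (1 - u)^(X n) = \prod_(1 <= j <= n) H_j (1 - u_(j,n)),
  u_(j,n) = rho_[j,n] B^(n-j) u.

The components of [u_(j,n)] are at most [rho_[j,n]], which tends to 0 for fixed
[j]. Each [H_j] is expanded at 1 up to order [k - 1]; Bonferroni's inequalities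
([bonferroni]), integrated, bound the error by the [k]-th term of the expansion
([taylor_rpgf]). The remaining estimates are averages over [j] with the weights
[rho_[j,n] (1 - rho j)], which are nonnegative, of total mass tending to 1, and
vanish in the limit for fixed [j]; hence averages of null sequences are null
([toeplitz]). This disposes of the error terms, because the [k]-th factorial
moments are [o(1 - rho j)], and of the squares of [1 - H_j (1 - u_(j,n))], so that
the product may be replaced by the exponential of the sum
([prod_expR_approx]). The terms of order [i >= 2] of the sum converge to the [Lambda]
terms by hypothesis, and the terms of order 1 to [lambda A], because
[mean (eps j) / (1 - rho j)] tends to [lambda].

The matrix [A] is obtained as in the mean ergodic theorem
([weighted_powers_cvg]). Neighbouring weights are asymptotically equal, so
multiplying the averaged powers of [B] by [B - 1] gives a null sequence; as the
powers of [B] are bounded, the kernel and the image of [B - 1] are complementary,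
and the average converges to the projection onto the former along the latter.

The hypotheses speak of iterated left derivatives of generating functions at
the boundary point 1, which may be infinite. [iter_partial_pgf] computes them: such a
derivative is a factorial moment, or [+oo] as soon as one of the intermediate
derivatives is. The hypothesis on [Lambda] excludes infinite derivatives of the
orders 2 to [k - 1] except at immigration times [j] after which some [rho]
vanishes ([partials_finite]), and these have coefficient 0 in all sums for
large [n].

Finally, convergence of the generating functions on the unit cube to a function
close to 1 near the point 1 yields a limit law ([continuity_theorem]): the
coordinates are treated one after the other, the indicator of a value being a
uniform limit of combinations of powers, so all point probabilities converge;
no mass escapes because the limit is continuous at 1. *)

(** * Limits of real sequences *)

Section SequenceLimits.
Context (R : realType).
Implicit Types (u v : nat -> R).

Lemma cvg_seq_sum (I : Type) (r : seq I) (Q : pred I) (F : I -> nat -> R) (a : I -> R) :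
  (forall i, Q i -> F i n @[n --> \oo] --> a i) ->
  \sum_(i <- r | Q i) F i n @[n --> \oo] --> \sum_(i <- r | Q i) a i.
Proof.
move=> Fa; elim: r => [|i r IHr].
  by rewrite big_nil; under eq_fun do rewrite big_nil; exact: cvg_cst.
rewrite big_cons; under eq_fun do rewrite big_cons.
by case: ifP => // Qi; apply: cvgD => //; apply: Fa.
Qed.

Lemma cvg_seqMl u (a c : R) : u n @[n --> \oo] --> a -> c * u n @[n --> \oo] --> c * a.
Proof. by move=> ua; apply: cvgM => //; exact: cvg_cst. Qed.

Lemma cvg_seqX u (a : R) k : u n @[n --> \oo] --> a -> u n ^+ k @[n --> \oo] --> a ^+ k.
Proof.
move=> ua; elim: k => [|k IHk].
  by rewrite expr0; under eq_fun do rewrite expr0; exact: cvg_cst.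
by rewrite exprS; under eq_fun do rewrite exprS; apply: cvgM.
Qed.

Lemma cvg_seq_dominated u v : (forall n, `|u n| <= v n) ->
  v n @[n --> \oo] --> 0 -> u n @[n --> \oo] --> 0.
Proof.
move=> uv v0; apply/norm_cvg0P; apply: (squeeze_cvgr _ (cvg_cst 0) v0).
by apply: nearW => n; rewrite normr_ge0 uv.
Qed.

Lemma cvg_uniform_approx u :
  (forall e, 0 < e -> exists2 v, cvgn v & forall n, `|u n - v n| <= e) -> cvgn u.
Proof.
move=> uv; apply/cauchy_cvgP; apply/cauchy_exP => e e0.
have e2 : 0 < e / 2 by rewrite divr_gt0.
have [v /cvg_ex[l vl] uvn] := uv _ e2; exists l.
have /cvgrPdist_lt/(_ _ e2) := vl; apply: filterS => n vln.
rewrite /ball/= (splitr e) -[l](subrK (v n)) -addrA (le_lt_trans (ler_normD _ _))//.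
by rewrite ltr_leD// distrC.
Qed.

End SequenceLimits.

Lemma cvg_mx_entries (R : realType) m p (F : nat -> 'M[R]_(m, p)) (A : 'M[R]_(m, p)) :
  F n @[n --> \oo] --> A <-> forall i j, F n i j @[n --> \oo] --> A i j.
Proof.
split=> [/cvg_mx_entourageP FA i j|FA].
  apply/cvg_entourageP => E entE.
  have : \forall n \near \oo, forall i j, (A i j, F n i j) \in E by exact: FA.
  by apply: (@filterS _ \oo) => n /(_ i j); rewrite inE.
apply/cvg_mx_entourageP => E entE.
have : \forall n \near \oo, forall i j, E (A i j, F n i j).
  apply: (@filter_forall _ _ (fun i n => forall j, E (A i j, F n i j))) => i.
  apply: (@filter_forall _ _ (fun j n => E (A i j, F n i j))) => j.
  by have /cvg_entourageP/(_ _ entE) := FA i j.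
by apply: filterS => n En i j; rewrite inE; exact: En.
Qed.

(** * Bonferroni's inequalities *)

Section Bonferroni.
Context (R : realType) (d : nat).
Implicit Types (v : 'rV[nat]_d) (u : 'rV[R]_d) (s : seq 'I_d).

(** The number of ways to choose distinct individuals of the successive types [s]
    in a population with [v l] individuals of type [l], and also the constant
    produced by differentiating [x ^ v] along [s]. *)
Definition falling v s : nat := \prod_l v ord0 l ^_ count_mem l s.

Definition decr v l : 'rV[nat]_d := \row_m (v ord0 m - (m == l))%N.

(** [i`!] times the [i]-th elementary symmetric function of the numbers [u l],
    each repeated [v l] times. *)
Definition tuple_moment u i v : R :=
  \sum_(s : i.-tuple 'I_d) (falling v s)%:R * \prod_(l <- s) u ord0 l.

Lemma falling_nil v : falling v [::] = 1%N.
Proof. by rewrite /falling big1. Qed.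

Lemma falling_cons v l s :
  falling v (l :: s) = (v ord0 l * falling (decr v l) s)%N.
Proof.
rewrite /falling (bigD1 l)//= (bigD1 l (P := predT))//= eqxx ffactnS mulnA.
rewrite mxE eqxx subn1; congr (_ * _)%N.
by apply: eq_bigr => m ml; rewrite mxE eq_sym (negPf ml) subn0.
Qed.

Lemma sum_tuple_cons (V : nmodType) (T : finType) i (F : i.+1.-tuple T -> V) :
  \sum_(s : i.+1.-tuple T) F s = \sum_x \sum_(s : i.-tuple T) F [tuple of x :: s].
Proof.
rewrite pair_big/= (reindex (fun p : T * i.-tuple T => [tuple of p.1 :: p.2]))//=.
exists (fun t : i.+1.-tuple T => (thead t, [tuple of behead t])) => [[x t] _|t _] /=.
  by congr (_, _); apply: val_inj.
by rewrite [RHS]tuple_eta; apply: val_inj.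
Qed.

Lemma tuple_moment0 u v : tuple_moment u 0 v = 1.
Proof.
rewrite /tuple_moment (big_pred1 [tuple]) => [|t]; last by apply/esym/eqP/tuple0.
by rewrite falling_nil big_nil mulr1.
Qed.

Lemma tuple_momentS u i v :
  tuple_moment u i.+1 v =
  \sum_l (v ord0 l)%:R * u ord0 l * tuple_moment u i (decr v l).
Proof.
rewrite /tuple_moment sum_tuple_cons; apply: eq_bigr => l _.
rewrite mulr_sumr; apply: eq_bigr => s _.
rewrite falling_cons natrM big_cons; ring.
Qed.

Lemma decr_incr v l : decr (v + delta_mx ord0 l) l = v.
Proof.
by apply/rowP => m; rewrite !mxE eqxx/=; case: (m == l); rewrite ?addr0 ?addrK ?subn0// addnK.
Qed.

Lemma incr_decr v l : (0 < v ord0 l)%N -> decr v l + delta_mx ord0 l = v.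
Proof.
move=> vl; apply/rowP => m; rewrite !mxE eqxx/=; case: eqP => [->|_].
  by rewrite [LHS](subnK vl).
by rewrite subn0 addr0.
Qed.

Lemma decr_incrC v l m : (0 < v ord0 m)%N ->
  decr (v + delta_mx ord0 l) m = decr v m + delta_mx ord0 l.
Proof.
move=> vm; apply/rowP => n; rewrite !mxE eqxx/=.
case: (altP (n =P m)) => [->|_]; last by rewrite !subn0.
exact: (esym (addnBAC _ vm)).
Qed.

(** Of the [i]-tuples of distinct individuals of the enlarged population, those
    that use the new one have it in one of [i] positions. *)
Lemma tuple_moment_incr u i v l :
  tuple_moment u i (v + delta_mx ord0 l) =
  tuple_moment u i v + i%:R * u ord0 l * tuple_moment u i.-1 v.
Proof.
elim: i v => [|i IHi] v; first by rewrite !tuple_moment0 !mul0r addr0.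
have step (m : 'I_d) : ((v + delta_mx ord0 l)%R ord0 m)%:R * u ord0 m *
    tuple_moment u i (decr (v + delta_mx ord0 l) m) =
  (if m == l then u ord0 l * tuple_moment u i v else 0) +
  (v ord0 m)%:R * u ord0 m * tuple_moment u i (decr v m + delta_mx ord0 l).
  rewrite [(v + _) ord0 m]mxE [delta_mx _ _ ord0 m]mxE eqxx/=.
  case: (altP (m =P l)) => [->|ml].
    rewrite decr_incr natrD mulrDl mulrDl addrC mul1r; congr (_ + _).
    case: (posnP (v ord0 l)) => [->|vl]; first by rewrite !mul0r.
    by rewrite incr_decr.
  rewrite add0r addr0; case: (posnP (v ord0 m)) => [->|vm]; first by rewrite !mul0r.
  by rewrite decr_incrC.
rewrite tuple_momentS (eq_bigr _ (fun m _ => step m)) big_split/=.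
rewrite -big_mkcond/= big_pred1_eq (eq_bigr (fun m =>
  (v ord0 m)%:R * u ord0 m * tuple_moment u i (decr v m) +
  i%:R * u ord0 l * ((v ord0 m)%:R * u ord0 m * tuple_moment u i.-1 (decr v m)))).
  rewrite big_split/= -tuple_momentS -mulr_sumr; case: i {IHi step} => [|i].
    by rewrite !mul0r addr0 addrC; ring.
  rewrite -tuple_momentS -[i.+2%:R]natr1; ring.
by move=> m _; rewrite IHi; ring.
Qed.

Lemma row_nat_ind (Q : 'rV[nat]_d -> Prop) :
  Q 0 -> (forall v l, Q v -> Q (v + delta_mx ord0 l)) -> forall v, Q v.
Proof.
move=> Q0 QS v; move: {2}(\sum_l v ord0 l)%N (erefl (\sum_l v ord0 l)%N) => n.
elim: n v => [|n IHn] v.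
  move=> /eqP; rewrite sum_nat_eq0 => /forallP v0.
  suff -> : v = 0 by [].
  by apply/rowP => l; rewrite mxE; apply/eqP/(implyP (v0 l)).
move=> vn; have [l vl] : exists l, (0 < v ord0 l)%N.
  apply/existsP; apply: contra_eqT vn; rewrite negb_exists => /forallP v0.
  by rewrite big1// => l _; apply/eqP; rewrite -leqn0 leqNgt.
rewrite -(incr_decr vl); apply: QS; apply: IHn; apply: succn_inj; rewrite -vn.
rewrite [in RHS](bigD1 l)//= [in LHS](bigD1 l)//= mxE eqxx subn1 -addSn prednK//.
by congr (_ + _)%N; apply: eq_bigr => m /negPf ml; rewrite mxE ml subn0.
Qed.

(** The sign makes the remainders of the alternating sum nonnegative. *)
Definition bonferroni_rest u k v : R :=
  (-1) ^+ k * (\prod_l (1 - u ord0 l) ^+ v ord0 l -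
    \sum_(i < k) (-1) ^+ i / i`!%:R * tuple_moment u i v).

Lemma bonferroni_restS u k v :
  bonferroni_rest u k v = tuple_moment u k v / k`!%:R - bonferroni_rest u k.+1 v.
Proof.
rewrite /bonferroni_rest big_ord_recr/= exprS.
set a := (-1) ^+ k; set S := \sum_(i < k) _; set p := \prod_l _.
have a2 : a * a = 1 by rewrite -expr2 /a sqrr_sign.
transitivity (tuple_moment u k v / k`!%:R * (1 - a * a) + a * (p - S)).
  by rewrite a2 subrr mulr0 add0r.
ring.
Qed.

Lemma bonferroni_rest_incr u k v l :
  bonferroni_rest u k.+1 (v + delta_mx ord0 l) =
  bonferroni_rest u k.+1 v + u ord0 l * bonferroni_rest u k v.
Proof.
rewrite /bonferroni_rest.
have -> : \prod_m (1 - u ord0 m) ^+ (v + delta_mx ord0 l)%R ord0 m =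
    (1 - u ord0 l) * \prod_m (1 - u ord0 m) ^+ v ord0 m.
  rewrite (bigD1 l)//= [in RHS](bigD1 l)//= !mxE !eqxx mulrA -exprS.
  congr (_ ^+ _ * _); first by rewrite addrC.
  by apply: eq_bigr => m /negPf ml; rewrite !mxE ml andbF addr0.
rewrite (eq_bigr (fun i : 'I_k.+1 => (-1) ^+ i / i`!%:R * tuple_moment u i v +
   (-1) ^+ i / i`!%:R * (i%:R * u ord0 l * tuple_moment u i.-1 v))); last first.
  by move=> i _; rewrite tuple_moment_incr mulrDr.
rewrite big_split/= [X in _ - (_ + X)]big_ord_recl/= !mul0r mulr0 add0r.
rewrite (eq_bigr (fun i : 'I_k => - u ord0 l *
    ((-1) ^+ i / i`!%:R * tuple_moment u i v))); last first.
  move=> i _; rewrite /bump/= add1n factS natrM exprS.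
  have : i.+1%:R != 0 :> R by rewrite pnatr_eq0.
  have : i`!%:R != 0 :> R by rewrite pnatr_eq0 -lt0n fact_gt0.
  by move: (i.+1%:R) (i`!%:R) => a b b0 a0; field; rewrite a0 b0.
rewrite -mulr_sumr exprS; ring.
Qed.

(** Bonferroni's inequalities for the event that none of a population of
    independent individuals is marked, an individual of type [l] being marked
    with probability [u l]. Adding one individual gives
    [rest k.+1 (v + e_l) = rest k.+1 v + u l * rest k v], so that all rests are
    nonnegative; the upper bound is the nonnegativity of the next rest. *)
Lemma bonferroni u k v : (forall l, 0 <= u ord0 l <= 1) ->
  0 <= bonferroni_rest u k v <= tuple_moment u k v / k`!%:R.
Proof.
move=> u01; have rest_ge0 j w : 0 <= bonferroni_rest u j w.
  elim/row_nat_ind: w j => [|w l IHw] [|j].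
  - rewrite /bonferroni_rest expr0 mul1r big_ord0 subr0.
    by apply: prodr_ge0 => l _; rewrite exprn_ge0// subr_ge0; case/andP: (u01 l).
  - rewrite /bonferroni_rest big1 => [|l _]; last by rewrite mxE expr0.
    rewrite big_ord_recl/= tuple_moment0 fact0 divr1 mulr1 opprD addrA subrr add0r.
    rewrite big1 ?oppr0 ?mulr0// => i _; rewrite /bump/= add1n tuple_momentS.
    by rewrite big1 ?mulr0// => l _; rewrite mxE !mul0r.
  - rewrite /bonferroni_rest expr0 mul1r big_ord0 subr0.
    by apply: prodr_ge0 => m _; rewrite exprn_ge0// subr_ge0; case/andP: (u01 m).
  - by have /andP[ul _] := u01 l; rewrite bonferroni_rest_incr addr_ge0// mulr_ge0.
by rewrite rest_ge0/= bonferroni_restS gerBl.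
Qed.

End Bonferroni.

(** * Independence of discrete random vectors *)

Section DiscreteVectors.
Context (disp : measure_display) (Omega : measurableType disp) (R : realType).
Variable P : probability Omega R.
Variable d : nat.
Implicit Types (V : Omega -> 'rV[nat]_d) (E : set Omega).

(** Vectors are enumerated by their codes so that countable partitions can be
    indexed by [nat]. A number that is not a code is decoded as 0, but the fiber
    over it is empty. *)
Definition decode (m : nat) : 'rV[nat]_d := odflt (0 : 'rV[nat]_d) (unpickle m).

Lemma pickle_decode (v : 'rV[nat]_d) : decode (pickle v) = v.
Proof. by rewrite /decode pickleK. Qed.

Definition code_fiber V m := V @^-1` [set v | pickle v = m].

Lemma code_fiberE V m w : code_fiber V m w -> V w = decode m.
Proof. by move=> <-; rewrite pickle_decode. Qed.

Lemma bigcup_code_fiber V : \bigcup_m code_fiber V m = setT.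
Proof. by apply/seteqP; split=> // w _; exists (pickle (V w)). Qed.

Lemma trivIset_code_fiber V E (C : nat -> set Omega) :
  trivIset setT (fun m => E `&` code_fiber V m `&` C m).
Proof. by move=> i j _ _ [w [[[_ <-] _] [[_ <-] _]]]. Qed.

Lemma measurable_preimage_vec V A : measurable_fun setT V -> measurable (V @^-1` A).
Proof. by move=> mV; rewrite -[_ @^-1` _]setTI; apply: mV. Qed.

Lemma measurable_code_fiber V m : measurable_fun setT V -> measurable (code_fiber V m).
Proof. exact: measurable_preimage_vec. Qed.

Lemma measurable_funT_vec V (f : 'rV[nat]_d -> R) D :
  measurable_fun setT V -> measurable_fun D (fun w => f (V w)).
Proof.
move=> mV; apply: (@measurable_funS _ _ _ _ setT) => //.
apply: (measurableT_comp _ mV); move=> _ Y _; exact: I.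
Qed.

(** Conditioning on the value of a discrete vector. *)
Lemma integral_code_fiber V E (h : Omega -> \bar R) :
  measurable_fun setT V -> measurable E -> measurable_fun E h ->
  (forall w, 0 <= h w)%E ->
  (\int[P]_(w in E) h w =
   \sum_(0 <= m <oo) \int[P]_(w in E `&` code_fiber V m) h w)%E.
Proof.
move=> mV mE mh h0.
have EE : E = \bigcup_m (E `&` code_fiber V m).
  by rewrite -setI_bigcupr bigcup_code_fiber setIT.
rewrite {1}EE ge0_integral_bigcup//.
- by move=> m; apply: measurableI => //; apply: measurable_code_fiber.
- by rewrite -EE.
- by move=> i j _ _ [w [[_ <-] [_ <-]]].
Qed.

Lemma integral_vec V (f : 'rV[nat]_d -> R) :
  measurable_fun setT V -> (forall v, 0 <= f v) ->
  (\int[P]_w (f (V w))%:E =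
   \sum_(0 <= m <oo) (f (decode m))%:E * P (code_fiber V m))%E.
Proof.
move=> mV f0; rewrite (integral_code_fiber mV)//; last 2 first.
- by apply/measurable_EFinP; apply: measurable_funT_vec.
- by move=> w; rewrite lee_fin.
apply: eq_eseriesr => m _; rewrite setTI.
rewrite (eq_integral (cst (f (decode m))%:E)) => [|w /set_mem /code_fiberE -> //].
by rewrite integral_cst//; apply: measurable_code_fiber.
Qed.

End DiscreteVectors.

Section Independence.
Context (disp : measure_display) (Omega : measurableType disp) (R : realType).
Variable P : probability Omega R.
Context (d : nat) (I : eqType) (V : I -> Omega -> 'rV[nat]_d).
Hypothesis mV : forall t, measurable_fun setT (V t).
Implicit Types (E : set Omega) (L : pred I) (J K : seq I).

(** Independence of an event from a family of vectors. Unlike a product formula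
    for finitely many vectors, it is stable under countable disjoint unions, as
    needed for sums with a random number of terms. *)
Definition indep_event L E := measurable E /\
  forall J, uniq J -> {subset J <= L} -> forall A : I -> set 'rV[nat]_d,
    P (E `&` \bigcap_(t in [set` J]) V t @^-1` A t) =
    (P E * \prod_(t <- J) P (V t @^-1` A t))%E.

Let capJ_cons t J (F : I -> set Omega) : \bigcap_(s in [set` t :: J]) F s =
  F t `&` \bigcap_(s in [set` J]) F s.
Proof.
rewrite -bigcap_setU1; congr (\bigcap_(s in _) F s).
apply/seteqP; split=> s /=; rewrite inE; first by move=> /predU1P.
by move=> st; apply/predU1P.
Qed.

Let mcap J (A : I -> set 'rV[nat]_d) :
  measurable (\bigcap_(t in [set` J]) V t @^-1` A t).
Proof.
elim: J => [|t J IHJ]; first by rewrite set_nil bigcap_set0; exact: measurableT.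
rewrite capJ_cons; apply: measurableI => //.
exact: measurable_preimage_vec.
Qed.

Lemma indep_eventT (D : pred I) : mutually_independent P D V -> indep_event D setT.
Proof.
move=> ind; split=> // J uJ JD A.
by rewrite setTI probability_setT mul1e; apply: ind.
Qed.

Lemma indep_event0 L : indep_event L set0.
Proof. by split=> // J _ _ A; rewrite set0I measure0 mul0e. Qed.

Lemma indep_eventS L L' E : {subset L' <= L} -> indep_event L E -> indep_event L' E.
Proof. by move=> sL [mE ind]; split=> // J uJ JL A; apply: ind => // t /JL /sL. Qed.

Lemma indep_event_bigcup L (F : nat -> set Omega) : trivIset setT F ->
  (forall m, indep_event L (F m)) -> indep_event L (\bigcup_m F m).
Proof.
move=> tF iF; have mF m : measurable (F m) by case: (iF m).
split; first exact: bigcupT_measurable.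
move=> J uJ JL A; rewrite setI_bigcupl measure_bigcup//=; last 2 first.
- by move=> m _; apply: measurableI => //; apply: mcap.
- exact: trivIset_setIr.
rewrite measure_bigcup//=.
have -> : (\prod_(t <- J) P (V t @^-1` A t))%E =
    (\prod_(t <- J) fine (P (V t @^-1` A t)))%:E.
  by rewrite -prodEFin; apply: eq_bigr => t _; rewrite fineK// fin_num_measure//;
    apply: measurable_preimage_vec.
rewrite muleC -nneseriesZl//; apply: eq_eseriesr => m _.
case: (iF m) => _ ->//; rewrite muleC; congr (_ * _)%E.
rewrite -prodEFin; apply: eq_bigr => t _; rewrite fineK// fin_num_measure//.
exact: measurable_preimage_vec.
Qed.

Lemma indep_event_preimage L E t A : indep_event L E -> t \in L ->
  P (E `&` V t @^-1` A) = (P E * P (V t @^-1` A))%E.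
Proof.
move=> [mE ind] tL; have := ind [:: t] isT _ (fun=> A).
rewrite big_seq1 set_cons1 bigcap_set1; apply.
by move=> s; rewrite inE => /eqP ->.
Qed.

Lemma indep_eventI L E t A : indep_event L E -> t \in L ->
  indep_event [pred s in L | s != t] (E `&` V t @^-1` A).
Proof.
move=> iE tL; have [mE ind] := iE.
split; first by apply: measurableI => //; apply: measurable_preimage_vec.
move=> J uJ JL A'; have tJ : t \notin J.
  by apply/negP => /JL; rewrite inE eqxx andbF.
pose A'' s := if s == t then A else A' s.
have A''J s : s \in J -> A'' s = A' s.
  by rewrite /A''; case: eqP => // -> /negPn; rewrite tJ.
have := ind (t :: J) _ _ A''; rewrite /= tJ uJ capJ_cons big_cons.
rewrite {1 3}/A'' eqxx setIA (indep_event_preimage _ iE)// muleA.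
rewrite (eq_big_seq (fun s => P (V s @^-1` A' s))) => [|s /A''J -> //].
rewrite (eq_bigcapr (G := fun s => V s @^-1` A' s)) => [|s /= /A''J -> //].
apply=> // s; rewrite inE => /predU1P[->//|/JL].
by rewrite inE => /andP[].
Qed.

(** The sum over [t :: K] lies in [C] in one of countably many disjoint ways, according
    to the value of [V t]; each of them confines the sum over [K] to another set. *)
Lemma indep_event_sum L E K (C : set 'rV[nat]_d) :
  indep_event L E -> uniq K -> {subset K <= L} ->
  indep_event [pred s in L | s \notin K]
    (E `&` [set w | C (\sum_(t <- K) V t w)]).
Proof.
elim: K E L C => [|t K IHK] E L C iE.
  move=> _ _; apply: (@indep_eventS L); first by move=> s; rewrite inE => /andP[].
  have [C0|C0] := pselect (C 0).
    suff -> : [set w | C (\sum_(t <- [::]) V t w)] = setT by rewrite setIT.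
    by apply/seteqP; split=> w //= _; rewrite big_nil.
  suff -> : [set w | C (\sum_(t <- [::]) V t w)] = set0.
    by rewrite setI0; apply: indep_event0.
  by apply/seteqP; split=> w //=; rewrite big_nil.
move=> /= /andP[tK uK] KL.
have -> : E `&` [set w | C (\sum_(s <- t :: K) V s w)] =
    \bigcup_m (E `&` code_fiber (V t) m `&`
       [set w | C (decode d m + \sum_(s <- K) V s w)]).
  apply/seteqP; split=> [w [Ew /= Cw]|w [m _ [[Ew Vm] /= Cw]]].
    by exists (pickle (V t w)) => //; split=> //=; move: Cw; rewrite pickle_decode big_cons.
  by split=> //=; rewrite big_cons (code_fiberE Vm).
apply: indep_event_bigcup; first exact: trivIset_code_fiber.
move=> m; apply: (@indep_eventS [pred s in [pred s in L | s != t] | s \notin K]).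
  by move=> s; rewrite !inE negb_or => /and3P[-> -> ->].
apply: (IHK _ _ [set v | C (decode d m + v)]) => //.
  by apply: indep_eventI => //; apply: KL; rewrite inE eqxx.
move=> s sK; rewrite inE KL ?inE ?sK ?orbT//=.
by apply: contraNneq tK => <-.
Qed.

Lemma prob_integral01 (f : Omega -> R) : measurable_fun setT f ->
  (forall w, 0 <= f w <= 1) -> (0 <= \int[P]_w (f w)%:E <= 1)%E.
Proof.
move=> mf f01; apply/andP; split.
  by apply: integral_ge0 => w _; rewrite lee_fin; case/andP: (f01 w).
rewrite -(probability_setT P) -[P setT]mul1e -(integral_cst P measurableT 1%E).
apply: ge0_le_integral => //.
- by move=> w _; rewrite lee_fin; case/andP: (f01 w).
- exact/measurable_EFinP.
- by move=> w _; rewrite lee_fin; case/andP: (f01 w).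
Qed.

(** Peeling off one factor splits [E] along the values of [V t], and each piece
    is again independent of the remaining vectors. *)
Lemma indep_event_integral L E K (f : I -> 'rV[nat]_d -> R) :
  indep_event L E -> uniq K -> {subset K <= L} -> (forall t v, 0 <= f t v <= 1) ->
  (\int[P]_(w in E) (\prod_(t <- K) f t (V t w))%:E =
   P E * \prod_(t <- K) \int[P]_w (f t (V t w))%:E)%E.
Proof.
move=> + + + f01; have f0 t v : 0 <= f t v by case/andP: (f01 t v).
have fE t : (\int[P]_w (f t (V t w))%:E)%E =
    (fine (\int[P]_w (f t (V t w))%:E)%E)%:E.
  rewrite fineK// ge0_fin_numE; last by apply: integral_ge0 => w _; rewrite lee_fin.
  have /andP[_] : (0 <= \int[P]_w (f t (V t w))%:E <= 1)%E.
    by apply: prob_integral01 => //; apply: measurable_funT_vec.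
  by move=> /le_lt_trans; apply; rewrite ltry.
elim: K E L => [|t K IHK] E L iE.
  move=> _ _; have [mE _] := iE; rewrite big_nil mule1.
  rewrite (eq_integral (cst 1%E)) => [|w _]; last by rewrite big_nil.
  by rewrite integral_cst// mul1e.
move=> /= /andP[tK uK] KL; have [mE _] := iE.
have tL : t \in L by apply: KL; rewrite inE eqxx.
have mprod D (J : seq I) : measurable_fun D (fun w => (\prod_(s <- J) f s (V s w))%:E).
  apply/measurable_EFinP; apply: measurable_prod => s _.
  exact: measurable_funT_vec.
rewrite (integral_code_fiber P (mV t))//; last first.
  by move=> w; rewrite lee_fin prodr_ge0.
rewrite big_cons (integral_vec P (mV t) (f0 t)).
have [mP iP] : {c : R | (P E * \prod_(s <- K) \int[P]_w (f s (V s w))%:E)%E = c%:E}.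
  exists (fine (P E) * \prod_(s <- K) fine (\int[P]_w (f s (V s w))%:E)%E).
  rewrite EFinM fineK ?fin_num_measure// -prodEFin; congr (_ * _)%E.
  by apply: eq_bigr => s _.
rewrite muleCA iP muleC -nneseriesZl; last first.
  by move=> m _; rewrite mule_ge0 ?lee_fin ?measure_ge0.
apply: eq_eseriesr => m _.
rewrite (eq_integral (fun w => (f t (decode d m))%:E *
    (\prod_(s <- K) f s (V s w))%:E)%E); last first.
  by move=> w /set_mem[_ /code_fiberE Vw]; rewrite big_cons Vw EFinM.
rewrite ge0_integralZl_EFin//; last 2 first.
- by apply: measurableI => //; apply: measurable_code_fiber.
- by move=> w _; rewrite lee_fin prodr_ge0.
rewrite (IHK _ _ (indep_eventI [set v | pickle v = m] iE tL))//; last first.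
  move=> s sK; rewrite inE KL ?inE ?sK ?orbT//=.
  by apply: contraNneq tK => <-.
by rewrite (indep_event_preimage _ iE)// -iP [RHS]muleCA [in LHS]muleAC.
Qed.

End Independence.

(** * Generating functions of random vectors *)

Lemma unit_cube_complement (R : numDomainType) d (y : 'rV[R]_d) :
  (forall l, 0 <= y ord0 l <= 1) -> forall l, 0 <= (const_mx 1 - y) ord0 l <= 1.
Proof.
by move=> y01 l; have /andP[y0 y1] := y01 l; rewrite !mxE subr_ge0 y1 gerBl.
Qed.

Section GeneratingFunctions.
Context (disp : measure_display) (Omega : measurableType disp) (R : realType).
Variable P : probability Omega R.
Variable d : nat.
Implicit Types (V : Omega -> 'rV[nat]_d) (x u p : 'rV[R]_d) (v : 'rV[nat]_d).

Definition monomial x v : R := \prod_l x ord0 l ^+ v ord0 l.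

Lemma monomial01 x v : (forall l, 0 <= x ord0 l <= 1) -> 0 <= monomial x v <= 1.
Proof.
move=> x01; apply/andP; split.
  by apply: prodr_ge0 => l _; rewrite exprn_ge0//; case/andP: (x01 l).
apply: prodr_ile1 => l _; have /andP[x0 x1] := x01 l.
by rewrite exprn_ge0//= exprn_ile1.
Qed.

Lemma monomial0 x : monomial x 0 = 1.
Proof. by rewrite /monomial big1// => l _; rewrite mxE expr0. Qed.

Lemma monomialD x v w : monomial x (v + w) = monomial x v * monomial x w.
Proof.
by rewrite /monomial -big_split/=; apply: eq_bigr => l _; rewrite mxE exprD.
Qed.

Lemma monomial_sum x I (r : seq I) (F : I -> 'rV[nat]_d) :
  monomial x (\sum_(t <- r) F t) = \prod_(t <- r) monomial x (F t).
Proof.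
by elim/big_rec2: _ => [|t y z _ <-]; rewrite (monomial0, monomialD).
Qed.

Lemma monomial_delta x l : monomial x (delta_mx ord0 l) = x ord0 l.
Proof.
rewrite /monomial (bigD1 l)//= mxE !eqxx expr1 big1 ?mulr1// => m /negPf ml.
by rewrite mxE ml andbF expr0.
Qed.

Lemma pgfE V x : pgf P V x = (\int[P]_w (monomial x (V w))%:E)%E.
Proof. by rewrite /pgf unlock. Qed.

Lemma pgf01 V x : measurable_fun setT V -> (forall l, 0 <= x ord0 l <= 1) ->
  (0 <= pgf P V x <= 1)%E.
Proof.
move=> mV x01; rewrite pgfE; apply: prob_integral01.
  exact: measurable_funT_vec.
by move=> w; apply: monomial01.
Qed.

Lemma nneseries_single (f : nat -> \bar R) n : (0 <= f n)%E ->
  (\sum_(0 <= m <oo) (f m * (m == n)%:R%:E) = f n)%E.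
Proof.
move=> f0; rewrite (nneseriesD1 (n := n))//; last first.
  by move=> m _; case: eqP => [->|_]; rewrite ?mule1 ?mule0.
rewrite eqxx mule1 eseries0 ?adde0// => m _ /= /negPf ->.
by rewrite mule0.
Qed.

(** The formula for [Be p] gives the mass of every fiber of the code, and only
    the codes of 0 and of the unit vectors contribute to the series. *)
Lemma pgf_Be V p x : measurable_fun setT V -> has_Be_law P V p ->
  (forall l, 0 <= x ord0 l) ->
  pgf P V x = (1 - \sum_l p ord0 l * (1 - x ord0 l))%:E.
Proof.
move=> mV lawV x0.
have deltaE (i j : 'I_d) : (delta_mx ord0 i == delta_mx ord0 j :> 'rV[nat]_d) = (i == j).
  apply/eqP/eqP => [/rowP/(_ i)|->//]; rewrite !mxE !eqxx/=.
  by case: eqP.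
have delta0 (i : 'I_d) : (delta_mx ord0 i == 0 :> 'rV[nat]_d) = false.
  by apply/eqP => /rowP/(_ i); rewrite !mxE !eqxx.
have d1E (a b : 'rV[nat]_d) : \d_a [set b] = (a == b)%:R%:E :> \bar R.
  by rewrite diracE; congr ((nat_of_bool _)%:R%:E); apply/idP/eqP; rewrite inE.
have p0 l : 0 <= p ord0 l.
  have : (0 <= P (V @^-1` [set delta_mx ord0 l : 'rV[nat]_d]))%E by [].
  rewrite lawV /Be d1E eq_sym delta0 mule0 add0e.
  rewrite (bigD1 l)//= d1E eqxx mule1 big1 ?adde0 ?lee_fin// => i il.
  by rewrite d1E deltaE (negPf il) mule0.
have q0 : 0 <= 1 - \sum_l p ord0 l.
  have : (0 <= P (V @^-1` [set (0 : 'rV[nat]_d)%R]))%E by [].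
  rewrite lawV /Be d1E eqxx mule1 [X in (_ + X)%E]big1 ?adde0 ?lee_fin// => i _.
  by rewrite d1E delta0 mule0.
have mon0 v : 0 <= monomial x v by apply: prodr_ge0 => l _; rewrite exprn_ge0.
rewrite pgfE (integral_vec P mV mon0).
have atom (a : 'rV[nat]_d) m : \d_a [set v | pickle v = m] = (m == pickle a)%:R%:E :> \bar R.
  by rewrite diracE; congr ((nat_of_bool _)%:R%:E); apply/idP/eqP; rewrite inE//.
have termE m : ((monomial x (decode d m))%:E * P (code_fiber V m) =
    (monomial x (decode d m))%:E * (1 - \sum_l p ord0 l)%:E * (m == pickle (0%R : 'rV[nat]_d))%:R%:E +
    \sum_i ((monomial x (decode d m))%:E * (p ord0 i)%:E *
       (m == pickle (delta_mx ord0 i : 'rV[nat]_d))%:R%:E))%E.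
  rewrite /code_fiber lawV /Be atom.
  under [X in (_ * (_ + X))%E]eq_bigr => i _ do rewrite atom -EFinM.
  rewrite sumEFin -!EFinM mulrDr mulrA EFinD; congr (_ + _)%E.
  rewrite mulr_sumr -sumEFin; apply: eq_bigr => i _.
  by rewrite -!EFinM mulrA.
under eq_eseriesr => m _ do rewrite termE.
rewrite nneseriesD; last 2 first.
- by move=> m _ _; rewrite -!EFinM lee_fin !mulr_ge0.
- by move=> m _ _; apply: sume_ge0 => i _; rewrite -!EFinM lee_fin !mulr_ge0.
rewrite nneseries_sum; last by move=> i m _; rewrite -!EFinM lee_fin !mulr_ge0.
rewrite (nneseries_single (f := fun m =>
  (monomial x (decode d m))%:E * (1 - \sum_l p ord0 l)%:E)%E); last first.
  by rewrite -EFinM lee_fin mulr_ge0.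
rewrite pickle_decode monomial0 mul1e.
rewrite (eq_bigr (fun i => (p ord0 i * x ord0 i)%:E)); last first.
  move=> i _; rewrite (nneseries_single (f := fun m =>
    (monomial x (decode d m))%:E * (p ord0 i)%:E)%E); last first.
    by rewrite -EFinM lee_fin mulr_ge0.
  by rewrite pickle_decode monomial_delta -EFinM mulrC.
rewrite sumEFin -EFinD; congr (_%:E).
under [in RHS]eq_bigr => i _ do rewrite mulrBr mulr1.
rewrite sumrB opprB addrCA addrA [LHS]addrC -!addrA; congr (_ + _).
Qed.

End GeneratingFunctions.

(** * The process as a product of immigration generating functions *)

Section Process.
Context (disp : measure_display) (Omega : measurableType disp) (R : realType).
Variable P : probability Omega R.
Context (d : nat) (xi : nat -> nat -> 'I_d -> {RV P >-> 'rV[nat]_d})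
  (eps : nat -> {RV P >-> 'rV[nat]_d}) (X : nat -> Omega -> 'rV[nat]_d).
Hypothesis gwiX : is_gwi xi eps X.

Definition time_of (t : (nat * nat * 'I_d) + nat) : nat :=
  match t with inl (n, _, _) => n | inr n => n end.

Definition later n : pred ((nat * nat * 'I_d) + nat) :=
  [pred t | gwi_index t && (n < time_of t)%N].

(** The indices of the vectors that are summed at time [n] when the previous state
    is [u]. *)
Definition generation n (u : 'rV[nat]_d) : seq ((nat * nat * 'I_d) + nat) :=
  inr n :: [seq inl (n, j, i) | i <- index_enum 'I_d, j <- index_iota 1 (u ord0 i).+1].

Lemma generation_time n u t : t \in generation n u -> time_of t = n.
Proof. by rewrite inE => /predU1P[->//|/allpairsPdep[i [j [_ _ ->]]]]. Qed.

Lemma generation_index n u t : (0 < n)%N -> t \in generation n u -> gwi_index t.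
Proof.
move=> n0; rewrite inE => /predU1P[->//|/allpairsPdep[i [j [_ + ->]]]] /=.
by rewrite n0 mem_index_iota => /andP[].
Qed.

Lemma generation_uniq n u : uniq (generation n u).
Proof.
rewrite /= allpairs_uniq_dep ?index_enum_uniq ?andbT//.
- by apply/negP => /allpairsPdep[i [j []]].
- by move=> i _; exact: iota_uniq.
- move=> [i j] [i' j'] _ _ /= [jj ii].
  by rewrite ii jj.
Qed.

Lemma measurable_gwi_family t : measurable_fun setT (gwi_family xi eps t).
Proof. by case: t => [[[n j] i]|n] /=; exact: measurable_funPT. Qed.

Lemma gwi_sum_generation n w :
  X n.+1 w = \sum_(t <- generation n.+1 (X n w)) gwi_family xi eps t w.
Proof.
by rewrite (gwi_rec gwiX) big_cons big_allpairs_dep addrC.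
Qed.

(** [X n] only looks at the variables up to time [n]. Given [X n = u], the next
    state is the sum of the finitely many vectors of [generation n.+1 u]. *)
Lemma gwi_indep_later n C :
  indep_event P (gwi_family xi eps) (later n) (X n @^-1` C).
Proof.
elim: n C => [|n IHn] C.
  have iT : indep_event P (gwi_family xi eps) (later 0) setT.
    apply: (@indep_eventS _ _ _ _ _ _ _ (@gwi_index d)).
      by move=> t /andP[].
    exact/indep_eventT/(gwi_indep gwiX).
  have [C0|C0] := pselect (C 0).
    suff -> : X 0%N @^-1` C = setT by [].
    by apply/seteqP; split=> // w _ /=; rewrite (gwi_init gwiX).
  suff -> : X 0%N @^-1` C = set0 by apply: indep_event0.
  by apply/seteqP; split=> // w /=; rewrite (gwi_init gwiX).
have -> : X n.+1 @^-1` C = \bigcup_m (setT `&` code_fiber (X n) m `&`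
    [set w | C (\sum_(t <- generation n.+1 (decode d m)) gwi_family xi eps t w)]).
  apply/seteqP; split=> [w /= Cw|w [m _ [[_ Xm] /= Cw]]].
    exists (pickle (X n w)) => //; split=> //=.
    by rewrite pickle_decode -gwi_sum_generation.
  by rewrite gwi_sum_generation (code_fiberE Xm).
apply: indep_event_bigcup => [||m].
- exact: measurable_gwi_family.
- exact: trivIset_code_fiber.
rewrite setTI; set K := generation _ _.
apply: (@indep_eventS _ _ _ _ _ _ _ [pred t in later n | t \notin K]).
  move=> t /andP[it nt]; rewrite !inE it/= (ltn_trans _ nt)//=.
  by apply: contraTN nt => /generation_time ->; rewrite ltnn.
apply: indep_event_sum; first exact: measurable_gwi_family.
- exact: IHn.
- exact: generation_uniq.
- by move=> t tK; rewrite inE (generation_index _ tK)// (generation_time tK) ltnSn.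
Qed.

Lemma measurable_gwi n : measurable_fun setT (X n).
Proof. by move=> _ C _; rewrite setTI; case: (gwi_indep_later n C). Qed.

(** Given [X n = u], [X n.+1] is a sum of independent vectors, so that its
    generating function is a product with [u i] factors of type [i]. *)
Lemma pgf_gwi_step n (x q : 'rV[R]_d) : (forall l, 0 <= x ord0 l <= 1) ->
  (forall i j, (0 < j)%N -> pgf P (xi n.+1 j i) x = (q ord0 i)%:E) ->
  pgf P (X n.+1) x = (pgf P (eps n.+1) x * pgf P (X n) q)%E.
Proof.
move=> x01 xiq.
have q0 i : 0 <= q ord0 i.
  have /andP[+ _] := pgf01 P (measurable_funPT (xi n.+1 1%N i)) x01.
  by rewrite xiq.
have mX := measurable_gwi.
have [c epsE] : {c | pgf P (eps n.+1) x = c%:E}.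
  exists (fine (pgf P (eps n.+1) x)); rewrite fineK//.
  have /andP[h0 h1] := pgf01 P (measurable_funPT (eps n.+1)) x01.
  by rewrite ge0_fin_numE// (le_lt_trans h1)// ltry.
rewrite [LHS]pgfE (integral_code_fiber P (mX n))//; last 2 first.
- by apply/measurable_EFinP/measurable_funT_vec.
- by move=> w; rewrite lee_fin; case/andP: (monomial01 (X n.+1 w) x01).
rewrite epsE [pgf P (X n) q]pgfE (integral_vec P (mX n)); last first.
  by move=> v; apply: prodr_ge0 => l _; rewrite exprn_ge0.
rewrite -nneseriesZl; last first.
  move=> m _; rewrite mule_ge0// lee_fin.
  by apply: prodr_ge0 => l _; rewrite exprn_ge0.
apply: eq_eseriesr => m _; rewrite setTI.
set K := generation n.+1 (decode d m).
rewrite (eq_integral (fun w =>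
    (\prod_(t <- K) monomial x (gwi_family xi eps t w))%:E)); last first.
  move=> w /set_mem /code_fiberE Xm.
  by rewrite -monomial_sum gwi_sum_generation Xm.
rewrite (indep_event_integral (f := fun=> monomial x) measurable_gwi_family
  (gwi_indep_later n [set v | pickle v = m]) (generation_uniq _ _)); last 2 first.
- by move=> t tK; rewrite inE (generation_index _ tK)// (generation_time tK) ltnSn.
- by move=> t v; apply: monomial01.
rewrite muleC muleA; congr (_ * _)%E.
rewrite big_cons -pgfE epsE big_allpairs_dep; congr (_ * _)%E.
rewrite -prodEFin; apply: eq_bigr => i _.
rewrite big_seq (eq_bigr (fun=> (q ord0 i)%:E)); last first.
  by move=> j; rewrite mem_index_iota -pgfE => /andP[j0 _]; apply: xiq.
by rewrite -big_seq prodEFin prodr_const_nat subn1.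
Qed.

End Process.

Section RealGeneratingFunction.
Context (disp : measure_display) (Omega : measurableType disp) (R : realType).
Variable P : probability Omega R.
Context (d : nat) (V : Omega -> 'rV[nat]_d).
Hypothesis mV : measurable_fun setT V.

Definition rpgf (x : 'rV[R]_d) : R := fine (pgf P V x).

Lemma rpgfE (x : 'rV[R]_d) : (forall l, 0 <= x ord0 l <= 1) -> pgf P V x = (rpgf x)%:E.
Proof.
move=> x01; rewrite /rpgf fineK//.
have /andP[h0 h1] := pgf01 P mV x01.
by rewrite ge0_fin_numE// (le_lt_trans h1)// ltry.
Qed.

Lemma rpgf01 (x : 'rV[R]_d) : (forall l, 0 <= x ord0 l <= 1) -> 0 <= rpgf x <= 1.
Proof. by move=> x01; rewrite -!lee_fin -rpgfE//; apply: pgf01. Qed.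

End RealGeneratingFunction.

Section Substochastic.
Context (R : realType) (d : nat) (B : 'M[R]_d).
Hypothesis B_sub : substochastic B.

Lemma substochastic_expr m : substochastic (B ^+ m).
Proof.
have [B0 B1] := B_sub; elim: m => [|m [IH0 IH1]].
  rewrite expr0; split=> [i j|i]; first by rewrite mxE.
  rewrite (bigD1 i)//= mxE eqxx big1 ?addr0// => j /negPf ji.
  by rewrite mxE eq_sym ji.
rewrite exprSr; split=> [i j|i].
  by rewrite mxE; apply: sumr_ge0 => l _; rewrite mulr_ge0.
under eq_bigr => j _ do rewrite mxE.
rewrite exchange_big/=; apply: le_trans (IH1 i).
by apply: ler_sum => l _; rewrite -mulr_sumr ler_piMr.
Qed.

Lemma substochastic_entry i j : 0 <= B i j <= 1.
Proof.
have [B0 B1] := B_sub; rewrite B0/=; apply: le_trans (B1 i).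
by rewrite (bigD1 j)//= lerDl sumr_ge0.
Qed.

Lemma substochastic_mulmx (u : 'rV[R]_d) i : (forall l, 0 <= u ord0 l <= 1) ->
  0 <= (u *m B^T) ord0 i <= 1.
Proof.
move=> u01; have [B0 B1] := B_sub; rewrite mxE; apply/andP; split.
  by apply: sumr_ge0 => l _; rewrite mulr_ge0// ?mxE//; case/andP: (u01 l).
apply: le_trans (B1 i); apply: ler_sum => l _.
by rewrite mxE ler_piMl//; case/andP: (u01 l).
Qed.

End Substochastic.

Section RhoProd.
Context (R : realType) (rho : nat -> R).
Hypothesis rho01 : forall n, (0 < n)%N -> 0 <= rho n <= 1.

Lemma rho_prodnn n : rho_prod rho n n = 1.
Proof. by rewrite /rho_prod big_geq. Qed.

Lemma rho_prodS j n : (j <= n)%N -> rho_prod rho j n.+1 = rho_prod rho j n * rho n.+1.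
Proof. by move=> jn; rewrite /rho_prod big_nat_recr. Qed.

Lemma rho_prod01 j n : 0 <= rho_prod rho j n <= 1.
Proof.
rewrite /rho_prod big_nat_cond; apply/andP; split.
  apply: prodr_ge0 => i /andP[/andP[ji _] _].
  by case/andP: (rho01 (leq_ltn_trans (leq0n j) ji)).
apply: prodr_ile1 => i /andP[/andP[ji _] _].
exact: (rho01 (leq_ltn_trans (leq0n j) ji)).
Qed.

Lemma rho_prod_split j n : (j < n)%N -> rho_prod rho j n = rho j.+1 * rho_prod rho j.+1 n.
Proof. by move=> jn; rewrite /rho_prod big_ltn. Qed.

End RhoProd.

Section BernoulliProcess.
Context (disp : measure_display) (Omega : measurableType disp) (R : realType).
Variable P : probability Omega R.
Context (d : nat) (xi : nat -> nat -> 'I_d -> {RV P >-> 'rV[nat]_d})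
  (eps : nat -> {RV P >-> 'rV[nat]_d}) (X : nat -> Omega -> 'rV[nat]_d).
Hypothesis gwiX : is_gwi xi eps X.
Hypothesis bernX : bernoulli_offspring xi.
Context (rho : nat -> R) (B : 'M[R]_d).
Hypothesis mean_rho : forall n, (0 < n)%N -> offspring_mean_mx xi n = rho n *: B.
Hypothesis B_sub : substochastic B.

(** An invertible nonnegative matrix has a positive entry, and the offspring means
    are nonnegative. *)
Lemma mean_ratio_ge0 : (0 < d)%N -> B \in unitmx -> forall n, (0 < n)%N -> 0 <= rho n.
Proof.
move=> d0 B_unit n n0; pose i0 := Ordinal d0.
have [B0 _] := B_sub.
have [l Bl] : exists l, B i0 l != 0.
  apply/existsP; apply: contraTT B_unit; rewrite negb_exists => /forallP Bi0.
  apply/negP => Bu; have := congr1 (fun M : 'M[R]_d => M i0 i0) (mulmxV Bu).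
  rewrite !mxE eqxx big1 => [/esym/eqP|l _]; first by rewrite oner_eq0.
  by have /negPn/eqP -> := Bi0 l; rewrite mul0r.
have : 0 <= offspring_mean_mx xi n i0 l.
  rewrite /offspring_mean_mx /mean mxE mxE fine_ge0// unlock.
  by apply: integral_ge0 => w _; rewrite lee_fin.
by rewrite mean_rho// mxE pmulr_lge0// lt_def Bl B0.
Qed.

Hypothesis rho01 : forall n, (0 < n)%N -> 0 <= rho n <= 1.

(** In the variable [1 - x], the composition of the offspring generating
    functions of the times [j + 1, ..., n]. *)
Definition propagate j n (u : 'rV[R]_d) : 'rV[R]_d :=
  rho_prod rho j n *: (u *m (B ^+ (n - j))^T).

Lemma propagate01 j n (u : 'rV[R]_d) : (forall l, 0 <= u ord0 l <= 1) ->
  forall l, 0 <= propagate j n u ord0 l <= rho_prod rho j n.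
Proof.
move=> u01 l; have /andP[r0 _] := rho_prod01 rho01 j n.
have /andP[h0 h1] := substochastic_mulmx (substochastic_expr B_sub (n - j)) l u01.
by rewrite mxE mulr_ge0//= ler_piMr.
Qed.

Lemma propagateS j n u : (j <= n)%N ->
  propagate j n (rho n.+1 *: (u *m B^T)) = propagate j n.+1 u.
Proof.
move=> jn; rewrite /propagate -scalemxAl scalerA rho_prodS// subSn//.
by rewrite exprSr -mulmxA -trmx_mul.
Qed.

(** The offspring generating functions [x |-> 1 - rho B (1 - x)] are affine,
    hence so are their compositions. *)
Lemma rpgf_gwi n (u : 'rV[R]_d) : (forall l, 0 <= u ord0 l <= 1) ->
  rpgf P (X n) (const_mx 1 - u) =
  \prod_(1 <= j < n.+1) rpgf P (eps j) (const_mx 1 - propagate j n u).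
Proof.
elim: n u => [|n IHn] u u01.
  rewrite big_geq// /rpgf pgfE (eq_integral (cst 1%E)) => [|w _].
    by rewrite integral_cst//= mul1e probability_setT.
  by rewrite (gwi_init gwiX) monomial0.
set u' := rho n.+1 *: (u *m B^T).
have u'01 l : 0 <= u' ord0 l <= 1.
  have /andP[r0 r1] := rho01 (ltn0Sn n).
  have /andP[h0 h1] := substochastic_mulmx B_sub l u01.
  by rewrite mxE mulr_ge0//= mulr_ile1.
have step : pgf P (X n.+1) (const_mx 1 - u) =
    (pgf P (eps n.+1) (const_mx 1 - u)%R * pgf P (X n) (const_mx 1 - u')%R)%E.
  apply: (pgf_gwi_step gwiX); first exact: unit_cube_complement.
  move=> i j j0; rewrite (pgf_Be (p := row i (offspring_mean_mx xi n.+1))).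
  - rewrite mean_rho// !mxE; congr (1 - _)%:E.
    rewrite mulr_sumr; apply: eq_bigr => l _; rewrite !mxE; ring.
  - exact: measurable_funPT.
  - by move=> A; rewrite (gwi_ident gwiX)//; apply: bernX.
  - by move=> l; case/andP: (unit_cube_complement u01 l).
rewrite {1}/rpgf step (rpgfE P (measurable_funPT (eps n.+1)) (unit_cube_complement u01)).
rewrite (rpgfE P (measurable_gwi gwiX n) (unit_cube_complement u'01)) -EFinM/= IHn//.
rewrite [RHS]big_nat_recr//= [LHS]mulrC; congr (_ * _).
  by apply: eq_big_nat => j /andP[_ jn]; rewrite propagateS.
by rewrite /propagate rho_prodnn subnn expr0 trmx1 mulmx1 scale1r.
Qed.

End BernoulliProcess.

(** * Iterated left derivatives of a generating function *)

Section IteratedPartials.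
Context (disp : measure_display) (Omega : measurableType disp) (R : realType).
Variable P : probability Omega R.
Context (d : nat) (V : Omega -> 'rV[nat]_d).
Hypothesis mV : measurable_fun setT V.
Implicit Types (x y : 'rV[R]_d) (v : 'rV[nat]_d) (s : seq 'I_d).

Definition deriv_monomial s x v : R :=
  (falling v s)%:R * \prod_l x ord0 l ^+ (v ord0 l - count_mem l s).

Definition deriv_moment s x : \bar R := (\int[P]_w (deriv_monomial s x (V w))%:E)%E.

(** The value of an iterated left partial derivative: once one of the
    intermediate derivatives is infinite, all further ones are. *)
Fixpoint deriv_value s x : \bar R :=
  if s is _ :: s' then
    if deriv_value s' x == +oo%E then +oo%E else deriv_moment s x
  else deriv_moment s x.

Lemma deriv_monomial_ge0 s x v : (forall l, 0 <= x ord0 l) -> 0 <= deriv_monomial s x v.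
Proof. by move=> x0; rewrite mulr_ge0// prodr_ge0// => l _; rewrite exprn_ge0. Qed.

Lemma deriv_monomial_le s x y v : (forall l, 0 <= x ord0 l <= y ord0 l) ->
  deriv_monomial s x v <= deriv_monomial s y v.
Proof.
move=> xy; rewrite ler_wpM2l// ler_prod// => l _; have /andP[x0 xyl] := xy l.
by rewrite exprn_ge0//= lerXn2r// nnegrE// (le_trans x0).
Qed.

Lemma measurable_deriv_monomial s x D :
  measurable_fun D (fun w => (deriv_monomial s x (V w))%:E).
Proof. by apply/measurable_EFinP/measurable_funT_vec. Qed.

Lemma deriv_moment_ge0 s x : (forall l, 0 <= x ord0 l) -> (0 <= deriv_moment s x)%E.
Proof. by move=> x0; apply: integral_ge0 => w _; rewrite lee_fin deriv_monomial_ge0. Qed.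

Lemma deriv_moment_le s x y : (forall l, 0 <= x ord0 l <= y ord0 l) ->
  (deriv_moment s x <= deriv_moment s y)%E.
Proof.
move=> xy; have x0 l : 0 <= x ord0 l by case/andP: (xy l).
have y0 l : 0 <= y ord0 l by have /andP[xl] := xy l; apply: le_trans.
apply: ge0_le_integral => //.
- by move=> w _; rewrite lee_fin deriv_monomial_ge0.
- exact: measurable_deriv_monomial.
- exact: measurable_deriv_monomial.
- by move=> w _; rewrite lee_fin deriv_monomial_le.
Qed.

Lemma deriv_moment_le_value s x : (deriv_moment s x <= deriv_value s x)%E.
Proof. by case: s => //= l s; case: ifP => // _; rewrite leey. Qed.

Lemma deriv_value_fin s x : (deriv_value s x < +oo)%E -> deriv_value s x = deriv_moment s x.
Proof. by case: s => //= l s; case: ifP => //; rewrite ltxx. Qed.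

(** Finiteness propagates to smaller arguments, so the difference quotients on the
    left of a point of finiteness are finite. *)
Lemma deriv_value_le_fin s x y : (forall l, 0 <= x ord0 l <= y ord0 l) ->
  (deriv_value s y < +oo)%E -> (deriv_value s x < +oo)%E.
Proof.
move=> xy; elim: s => [|l s IHs] /=; first exact/le_lt_trans/deriv_moment_le.
have [_|] := eqVneq (deriv_value s y) +oo%E; first by rewrite ltxx.
rewrite -ltey => /IHs xoo yoo; rewrite (lt_eqF xoo).
exact/le_lt_trans/yoo/deriv_moment_le.
Qed.

Lemma falling_consr v l s :
  falling v (l :: s) = (falling v s * (v ord0 l - count_mem l s))%N.
Proof.
rewrite /falling (bigD1 l)//= [in RHS](bigD1 l)//= eqxx add1n ffactnSr -!mulnA.
congr (_ * _)%N; rewrite mulnC; congr (_ * _)%N.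
by apply: eq_bigr => m ml; rewrite eq_sym (negPf ml).
Qed.

(** [(a ^+ n - (a - t) ^+ n) / t], written as a sum of terms that decrease in
    [t] and extend to [t = 0]. *)
Definition pow_quotient (a t : R) n := \sum_(i < n) a ^+ (n.-1 - i) * (a - t) ^+ i.

Definition deriv_quotient l s x (t : R) v : R :=
  (falling v s)%:R * (\prod_(m | m != l) x ord0 m ^+ (v ord0 m - count_mem m s)) *
  pow_quotient (x ord0 l) t (v ord0 l - count_mem l s).

Lemma deriv_quotientE l s x t v :
  deriv_monomial s x v = deriv_monomial s (x - t *: delta_mx ord0 l) v +
    t * deriv_quotient l s x t v.
Proof.
rewrite /deriv_monomial (bigD1 l)//= [in RHS](bigD1 l)//= !mxE !eqxx/= mulr1.
rewrite [in RHS](eq_bigr (fun m => x ord0 m ^+ (v ord0 m - count_mem m s))); last first.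
  by move=> m ml; rewrite !mxE (negPf ml) andbF mulr0 subr0.
rewrite /deriv_quotient; set K := \prod_(m | _) _; set n := (_ - _)%N.
have := subrXX (x ord0 l) (x ord0 l - t) n.
rewrite -/(pow_quotient _ _ _).
have -> : x ord0 l - (x ord0 l - t) = t by ring.
move=> /eqP; rewrite subr_eq => /eqP ->; ring.
Qed.

Lemma deriv_quotient0 l s x v : deriv_quotient l s x 0 v = deriv_monomial (l :: s) x v.
Proof.
rewrite /deriv_monomial falling_consr (bigD1 l)//= eqxx natrM.
rewrite [in RHS](eq_bigr (fun m => x ord0 m ^+ (v ord0 m - count_mem m s))); last first.
  by move=> m ml; rewrite eq_sym (negPf ml).
rewrite /deriv_quotient; set K := \prod_(m | _) _.
rewrite add1n subnS; set n := (_ - _)%N.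
have -> : pow_quotient (x ord0 l) 0 n = n%:R * x ord0 l ^+ n.-1.
  rewrite /pow_quotient subr0 (eq_bigr (fun=> x ord0 l ^+ n.-1)).
    by rewrite sumr_const card_ord mulr_natl.
  by move=> i _; rewrite -exprD subnK// -ltnS prednK// (leq_trans _ (ltn_ord i)).
ring.
Qed.

Lemma deriv_quotient_ge0 l s x t v : (forall m, 0 <= x ord0 m) -> t <= x ord0 l ->
  0 <= deriv_quotient l s x t v.
Proof.
move=> x0 tx; rewrite !mulr_ge0//.
  by apply: prodr_ge0 => m _; rewrite exprn_ge0.
by apply: sumr_ge0 => i _; rewrite mulr_ge0 ?exprn_ge0 ?subr_ge0.
Qed.

Lemma deriv_quotient_le l s x t t' v : (forall m, 0 <= x ord0 m) ->
  t <= t' -> t' <= x ord0 l -> deriv_quotient l s x t' v <= deriv_quotient l s x t v.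
Proof.
move=> x0 tt' tx; rewrite ler_wpM2l//.
  by rewrite mulr_ge0// prodr_ge0// => m _; rewrite exprn_ge0.
apply: ler_sum => i _; rewrite ler_wpM2l ?exprn_ge0//.
by rewrite lerXn2r ?nnegrE ?subr_ge0 ?lerB// (le_trans tt').
Qed.

Lemma measurable_deriv_quotient l s x t D :
  measurable_fun D (fun w => (deriv_quotient l s x t (V w))%:E).
Proof. by apply/measurable_EFinP/measurable_funT_vec. Qed.

Lemma deriv_quotient_cvg0 l s x v (u : nat -> R) : u n @[n --> \oo] --> 0 ->
  deriv_quotient l s x (u n) v @[n --> \oo] --> deriv_quotient l s x 0 v.
Proof.
move=> u0; apply: cvg_seqMl; apply: cvg_seq_sum => i _; apply: cvg_seqMl.
by apply: cvg_seqX; apply: cvgB => //; exact: cvg_cst.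
Qed.

(** The difference quotients increase to the derivative as the step decreases
    to 0; Fatou's lemma along one sequence of steps identifies the limit, be it
    finite or not. *)
Lemma integral_deriv_quotient_cvg l s x : (forall m, 0 < x ord0 m) ->
  (\int[P]_w (deriv_quotient l s x t (V w))%:E @[t --> 0^'+] --> deriv_moment (l :: s) x)%E.
Proof.
move=> xpos; have x0 m : 0 <= x ord0 m by apply: ltW.
pose Q t := (\int[P]_w (deriv_quotient l s x t (V w))%:E)%E.
have Qle t t' : t <= t' -> t' <= x ord0 l -> (Q t' <= Q t)%E.
  move=> tt' t'x; apply: ge0_le_integral => //.
  - by move=> w _; rewrite lee_fin deriv_quotient_ge0.
  - exact: measurable_deriv_quotient.
  - exact: measurable_deriv_quotient.
  - by move=> w _; rewrite lee_fin deriv_quotient_le.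
have Q0 : Q 0 = deriv_moment (l :: s) x.
  by apply: eq_integral => w _; rewrite deriv_quotient0.
have := @nonincreasing_at_right_cvge R Q 0 (BLeft (x ord0 l)) (xpos l).
set S := ereal_sup _ => Qcvg.
suff <- : S = deriv_moment (l :: s) x.
  apply: Qcvg => t t'; rewrite !in_itv/= => /andP[_ tx] /andP[_ t'x] tt'.
  exact: Qle (ltW t'x).
apply/eqP; rewrite eq_le -Q0; apply/andP; split.
  apply: ge_ereal_sup => y [t tin <-]; move: tin; rewrite /= in_itv/= => /andP[t0 tx].
  by apply: Qle; exact: ltW.
pose u n := x ord0 l / 2 * harmonic n.
have x2 : 0 < x ord0 l / 2 by rewrite divr_gt0.
have u0 n : 0 < u n by rewrite mulr_gt0 ?harmonic_gt0.
have ux n : u n < x ord0 l.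
  apply: (@le_lt_trans _ _ (x ord0 l / 2)); last by rewrite gtr_pMr// invf_lt1// ltr1n.
  by rewrite ler_piMr ?(ltW x2)// /harmonic/= invf_le1 ?ler1n ?ltr0n.
have ucvg : u n @[n --> \oo] --> 0.
  by rewrite -(mulr0 (x ord0 l / 2)); apply: cvg_seqMl; exact: cvg_harmonic.
have : (Q 0%R <= limn_einf (Q \o u))%E.
  pose f n w := (deriv_quotient l s x (u n) (V w))%:E.
  have mf n : measurable_fun setT (f n) by exact: measurable_deriv_quotient.
  have f0 n w : setT w -> (0 <= f n w)%E.
    by move=> _; rewrite lee_fin deriv_quotient_ge0// ltW.
  apply: le_trans (fatou P measurableT mf f0).
  rewrite le_eqVlt; apply/orP; left; apply/eqP; apply: eq_integral => w _.
  apply/esym; apply: (cvg_limn_einf_sup _).1; apply: cvg_EFin; first exact: nearW.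
  exact: deriv_quotient_cvg0.
move/le_trans; apply.
rewrite limn_einf_lim; apply: lime_le; first exact: is_cvg_einfs.
apply: nearW => n; apply: (@le_trans _ _ (Q (u n))).
  by apply: ereal_inf_lbound; exists n => /=.
by apply: ereal_sup_ubound; exists (u n) => //=; rewrite in_itv/= u0 ux.
Qed.

(** Where an intermediate derivative is [+oo], the difference quotients are
    [-oo * h^-1] with [h < 0], hence constantly [+oo]. Elsewhere they are the
    integrals of [deriv_quotient]. *)
Lemma iter_partial_pgf s x : (forall l, 0 < x ord0 l) ->
  iter_partial s (pgf P V) x = deriv_value s x.
Proof.
elim: s x => [|l s IHs] x xpos.
  rewrite /= pgfE; apply: eq_integral => w _; rewrite /deriv_monomial falling_nil mul1r.
  by congr (_%:E); apply: eq_bigr => l _; rewrite subn0.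
have x0 m : 0 <= x ord0 m by apply: ltW.
rewrite /= /left_partial -/(iter_partial s (pgf P V)) IHs//.
set g := iter_partial s (pgf P V).
have gE h : - x ord0 l < h ->
    g (x + h *: delta_mx ord0 l) = deriv_value s (x + h *: delta_mx ord0 l).
  move=> hx; apply: IHs => m; rewrite !mxE eqxx/=; case: eqP => [->|_].
    by rewrite mulr1 -ltrBlDl sub0r.
  by rewrite mulr0 addr0.
case: eqVneq => [goo|].
  apply: cvg_lim => //; rewrite goo; apply: cvg_near_cst.
  near=> h; have h0 : h < 0 by near: h; exact: nbhs_left_lt.
  rewrite addeNy lt0_mulNye// lte_fin invr_lt0.
  done.
rewrite -ltey => gfin; have gxE := deriv_value_fin gfin.
apply: cvg_lim => //.
rewrite -[0]oppr0 at_leftN.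
have : \forall t \near 0^'+, (\int[P]_w (deriv_quotient l s x t (V w))%:E)%E =
    ((g (x + (- t) *: delta_mx ord0 l)%R - deriv_value s x) * ((- t)^-1)%:E)%E.
  near=> t.
  have t0 : 0 < t by near: t; exact: nbhs_right_gt.
  have tx : t < x ord0 l by near: t; exact: nbhs_right_lt.
  set y := x + _.
  have yE : y = x - t *: delta_mx ord0 l by rewrite /y scaleNr.
  have yx m : 0 <= y ord0 m <= x ord0 m.
    rewrite yE !mxE eqxx/=; case: eqP => [->|_].
      by rewrite mulr1 subr_ge0 ltW//= gerBl ltW.
    by rewrite mulr0 subr0 lexx andbT.
  have yfin := deriv_value_le_fin yx gfin.
  have gyE := deriv_value_fin yfin.
  rewrite /y gE ?ltrN2// -/y gyE gxE.
  move: gfin yfin; rewrite gxE gyE => xfin yfin.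
  have Q0 : (0 <= \int[P]_w (deriv_quotient l s x t (V w))%:E)%E.
    by apply: integral_ge0 => w _; rewrite lee_fin deriv_quotient_ge0// ltW.
  have : (deriv_moment s x =
      deriv_moment s y + t%:E * \int[P]_w (deriv_quotient l s x t (V w))%:E)%E.
    rewrite -ge0_integralZl_EFin ?ltW//; last 2 first.
    - by move=> w _; rewrite lee_fin deriv_quotient_ge0// ltW.
    - exact: measurable_deriv_quotient.
    rewrite -ge0_integralD//; last 4 first.
    - by move=> w _; rewrite lee_fin deriv_monomial_ge0// => m; case/andP: (yx m).
    - exact: measurable_deriv_monomial.
    - by move=> w _; rewrite mule_ge0 ?lee_fin ?deriv_quotient_ge0// ltW.
    - by apply: emeasurable_funM => //; exact: measurable_deriv_quotient.
    apply: eq_integral => w _.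
    by rewrite (deriv_quotientE l s x t) -yE EFinD EFinM.
  have y0 := deriv_moment_ge0 s (fun m => proj1 (andP (yx m))).
  move: (deriv_moment_ge0 s x0) xfin y0 yfin Q0.
  case: (deriv_moment s x) => [a| |]// _ _; case: (deriv_moment s y) => [b| |]// _ _.
  case: (\int[P]_w _)%E => [q| |]// _; last by rewrite gt0_muley// lte_fin.
  rewrite -EFinM -EFinD => -[->]; rewrite -EFinB -EFinM; congr (_%:E).
  by field; rewrite gt_eqF.
move=> /near_eq_cvg /cvg_trans; apply.
exact: integral_deriv_quotient_cvg.
Unshelve. all: by end_near. Qed.

End IteratedPartials.

(** * Factorial moments and the Taylor expansion *)

Section FactorialMoments.
Context (disp : measure_display) (Omega : measurableType disp) (R : realType).
Variable P : probability Omega R.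
Context (d : nat) (V : Omega -> 'rV[nat]_d).
Hypothesis mV : measurable_fun setT V.
Implicit Types (u : 'rV[R]_d) (v : 'rV[nat]_d) (s : seq 'I_d).

Definition factorial_moment s : \bar R := (\int[P]_w ((falling (V w) s)%:R : R)%:E)%E.

Lemma deriv_moment1 s : deriv_moment P V s (const_mx 1) = factorial_moment s.
Proof.
apply: eq_integral => w _; rewrite /deriv_monomial big1 ?mulr1// => l _.
by rewrite mxE expr1n.
Qed.

Lemma factorial_moment_ge0 s : (0 <= factorial_moment s)%E.
Proof. by apply: integral_ge0 => w _; rewrite lee_fin. Qed.

Lemma falling_perm v s s' : (forall l, count_mem l s = count_mem l s') ->
  falling v s = falling v s'.
Proof. by move=> ss'; apply: eq_bigr => l _; rewrite ss'. Qed.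

Lemma falling1 v l : falling v [:: l] = v ord0 l.
Proof. by rewrite falling_cons falling_nil muln1. Qed.

Lemma integrable_falling s : (factorial_moment s < +oo)%E ->
  P.-integrable setT (EFin \o (fun w => (falling (V w) s)%:R : R)).
Proof.
move=> fin; apply/integrableP; split.
  apply/measurable_EFinP; exact: (measurable_funT_vec (fun v => (falling v s)%:R : R) (D := setT) mV).
rewrite (le_lt_trans _ fin)// le_eqVlt; apply/orP; left; apply/eqP.
by apply: eq_integral => w _ /=; rewrite ger0_norm.
Qed.

Lemma mean_factorial_moment l : mean P V ord0 l = fine (factorial_moment [:: l]).
Proof.
rewrite mxE unlock; congr fine; apply: eq_integral => w _.
by rewrite falling1.
Qed.

Lemma finite_mean_moment l : finite_mean P V -> (factorial_moment [:: l] < +oo)%E.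
Proof.
move=> /(_ l); rewrite unlock /factorial_moment.
by under eq_integral do rewrite -falling1.
Qed.

(** An infinite moment enters as 0, the value of [fine] at [+oo]. *)
Definition taylor_term i u : R :=
  \sum_(s : i.-tuple 'I_d) fine (factorial_moment s) * \prod_(l <- s) u ord0 l.

Lemma integrable_tuple_moment i u :
  (forall s : i.-tuple 'I_d, (factorial_moment s < +oo)%E) ->
  P.-integrable setT (EFin \o (fun w => tuple_moment u i (V w))).
Proof.
move=> fin; rewrite (_ : _ \o _ = (fun w => \sum_(s : i.-tuple 'I_d)
    ((\prod_(l <- s) u ord0 l)%:E * ((falling (V w) s)%:R : R)%:E)))%E; last first.
  apply/funext => w; rewrite /= /tuple_moment -sumEFin; apply: eq_bigr => s _.
  by rewrite mulrC EFinM.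
apply: integrable_sum => // s _; apply: integrableZl => //.
exact: integrable_falling.
Qed.

Lemma integral_tuple_moment i u :
  (forall s : i.-tuple 'I_d, (factorial_moment s < +oo)%E) ->
  (\int[P]_w tuple_moment u i (V w))%R = taylor_term i u.
Proof.
move=> fin; rewrite /Rintegral (eq_integral (fun w => \sum_(s : i.-tuple 'I_d)
    ((\prod_(l <- s) u ord0 l)%:E * ((falling (V w) s)%:R : R)%:E)))%E; last first.
  move=> w _; rewrite /tuple_moment -sumEFin; apply: eq_bigr => s _.
  by rewrite mulrC EFinM.
rewrite integral_sum//; last first.
  by move=> s; apply: integrableZl => //; exact: integrable_falling.
rewrite /taylor_term -sum_fine; last first.
  move=> s _; apply: integrable_fin_num => //; apply: integrableZl => //.
  exact: integrable_falling.
apply: eq_bigr => s _; rewrite integralZl//; last exact: integrable_falling.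
rewrite fineM//=; first by rewrite mulrC.
by rewrite ge0_fin_numE ?fin// factorial_moment_ge0.
Qed.

(** Bonferroni's inequalities, integrated: the factorial moments of the vector are
    the expectations of [falling]. *)
Lemma taylor_rpgf k u : (forall l, 0 <= u ord0 l <= 1) ->
  (forall i (s : i.-tuple 'I_d), (i <= k)%N -> (factorial_moment s < +oo)%E) ->
  `|rpgf P V (const_mx 1 - u) - \sum_(i < k) (-1) ^+ i / i`!%:R * taylor_term i u| <=
  taylor_term k u / k`!%:R.
Proof.
move=> u01 fin.
have fini i : (i <= k)%N -> forall s : i.-tuple 'I_d, (factorial_moment s < +oo)%E.
  by move=> ik s; apply: fin.
have y01 := unit_cube_complement u01.
have imon : P.-integrable setT (EFin \o (fun w => monomial (const_mx 1 - u) (V w))).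
  apply: measurable_bounded_integrable => //.
  - by apply: (le_lt_trans (probability_le1 P measurableT)); rewrite ltry.
  - exact: measurable_funT_vec.
  - exists 1; split; rewrite ?num_real// => y y1 w _ /=.
    have /andP[m0 m1] := monomial01 (V w) y01.
    by rewrite ger0_norm// (le_trans m1)// ltW.
pose part w := \sum_(i < k) (-1) ^+ i / i`!%:R * tuple_moment u i (V w).
have ipart0 : forall (i : 'I_k), P.-integrable setT
    (EFin \o (fun w => (-1) ^+ i / i`!%:R * tuple_moment u i (V w))).
  move=> i; rewrite (_ : _ \o _ = fun w => (((-1) ^+ i / i`!%:R)%:E *
      (EFin \o (fun w => tuple_moment u i (V w))) w)%E).
    apply: integrableZl => //; apply: integrable_tuple_moment.
    by apply: fini; apply: ltnW.
  by apply/funext => w; rewrite /= EFinM.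
have ipart : P.-integrable setT (EFin \o part).
  rewrite (_ : _ \o _ = fun w => \sum_(i < k)
      (EFin \o (fun w => ((-1) ^+ i / i`!%:R * tuple_moment u i (V w))%R)) w)%E.
    exact: integrable_sum.
  by apply/funext => w; rewrite /= /part -sumEFin.
have partE : (\int[P]_w part w)%R = \sum_(i < k) (-1) ^+ i / i`!%:R * taylor_term i u.
  rewrite /Rintegral (eq_integral (fun w => \sum_(i < k)
      (EFin \o (fun w => ((-1) ^+ i / i`!%:R * tuple_moment u i (V w))%R)) w)%E); last first.
    by move=> w _; rewrite /part -sumEFin.
  rewrite integral_sum// -sum_fine; last by move=> i _; apply: integrable_fin_num.
  apply: eq_bigr => i _; rewrite -integral_tuple_moment; last by apply: fini; apply: ltnW.
  rewrite -RintegralZl//; apply: integrable_tuple_moment.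
  by apply: fini; apply: ltnW.
have monE v : monomial (const_mx 1 - u) v = \prod_l (1 - u ord0 l) ^+ v ord0 l.
  by apply: eq_bigr => l _; rewrite !mxE.
rewrite -partE /rpgf pgfE -RintegralB//.
have itop : P.-integrable setT (EFin \o (fun w => k`!%:R^-1 * tuple_moment u k (V w))).
  rewrite (_ : _ \o _ = fun w => ((k`!%:R^-1)%:E *
      (EFin \o (fun w => tuple_moment u k (V w))) w)%E).
    by apply: integrableZl => //; apply: integrable_tuple_moment; exact: fini.
  by apply/funext => w; rewrite /= EFinM.
have idiff : P.-integrable setT
    (EFin \o (fun w => monomial (const_mx 1 - u) (V w) - part w)).
  rewrite (_ : _ \o _ = ((EFin \o (fun w => monomial (const_mx 1 - u)%R (V w))) \-
      (EFin \o part)))%E; first exact: integrableB.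
  by apply/funext => w.
apply: (le_trans (le_normr_Rintegral _ idiff)) => //.
rewrite -(integral_tuple_moment u (fini k (leqnn k))) mulrC -RintegralZl//; last first.
  by apply: integrable_tuple_moment; exact: fini.
apply: le_Rintegral => //; first exact: (integrable_norm idiff).
move=> w _; have /andP[r0 r1] := bonferroni k (V w) u01.
rewrite monE [leRHS]mulrC (le_trans _ r1)//.
move: r0; rewrite /bonferroni_rest -/(part w) => r0.
by rewrite -(ger0_norm r0) normrM normrX normrN1 expr1n mul1r.
Qed.

End FactorialMoments.

Lemma prod_sum_tuple (R : comPzSemiRingType) (T : finType) i (F : 'I_i -> T -> R) :
  \prod_(r < i) \sum_m F r m = \sum_(t : i.-tuple T) \prod_(r < i) F r (tnth t r).
Proof.
rewrite bigA_distr_bigA/= (reindex (fun t : i.-tuple T => [ffun r => tnth t r]))/=.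
  by apply: eq_bigr => t _; apply: eq_bigr => r _; rewrite ffunE.
exists (fun f : {ffun 'I_i -> T} => [tuple f r | r < i]) => [t _|f _].
  by apply: eq_from_tnth => r; rewrite tnth_mktuple ffunE.
by apply/ffunP => r; rewrite ffunE tnth_mktuple.
Qed.

Section ImmigrationMoments.
Context (disp : measure_display) (Omega : measurableType disp) (R : realType).
Variable P : probability Omega R.
Context (d : nat) (V : Omega -> 'rV[nat]_d).
Hypothesis mV : measurable_fun setT V.
Implicit Types (u : 'rV[R]_d) (s : seq 'I_d).

Let ones : 'rV[R]_d := const_mx 1.

Lemma factorial_moment_le_partial s :
  (factorial_moment P V s <= iter_partial s (pgf P V) ones)%E.
Proof.
rewrite iter_partial_pgf//; last by move=> l; rewrite mxE ltr01.
by rewrite -deriv_moment1; exact: deriv_moment_le_value.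
Qed.

Lemma iter_partial_ge0 s : (0 <= iter_partial s (pgf P V) ones)%E.
Proof. exact: le_trans (factorial_moment_ge0 _ _ _) (factorial_moment_le_partial _). Qed.

Lemma iter_partial_fin s : (iter_partial s (pgf P V) ones < +oo)%E ->
  iter_partial s (pgf P V) ones = (fine (factorial_moment P V s))%:E.
Proof.
move=> fin; rewrite fineK; last first.
  rewrite ge0_fin_numE ?factorial_moment_ge0//.
  exact: le_lt_trans (factorial_moment_le_partial _) fin.
move: fin; rewrite iter_partial_pgf// => [|l]; last by rewrite mxE ltr01.
by move=> /deriv_value_fin ->; rewrite deriv_moment1.
Qed.

(** A factorial moment depends on the tuple [s] only through its multiplicities,
    which form one of the multi-indices of the maximum. *)
Lemma factorial_moment_le_max k (s : k.-tuple 'I_d) :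
  (factorial_moment P V s <= max_partial k (pgf P V) ones)%E.
Proof.
have kc l : (count_mem l s < k.+1)%N by rewrite ltnS -{2}(size_tuple s) count_size.
pose c : {ffun 'I_d -> 'I_k.+1} := [ffun l => Ordinal (kc l)].
have sumc : (\sum_l c l == k)%N.
  apply/eqP; transitivity (size s); last exact: size_tuple.
  rewrite -sum1_size (eq_bigr (fun l => \sum_(m <- s) (m == l : nat))%N).
    rewrite exchange_big/=; apply: eq_bigr => m _.
    rewrite (bigD1 m)//= eqxx big1 ?addn0// => l /negPf ml.
    by rewrite eq_sym ml.
  by move=> l _; rewrite ffunE/= -sum1_count big_mkcond.
pose s' := flatten [seq nseq (c i) i | i <- enum 'I_d].
have cs' l : count_mem l s' = count_mem l s.
  rewrite /s' count_flatten -map_comp sumnE big_map -[RHS]/(nat_of_ord (Ordinal (kc l))).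
  rewrite (eq_bigr (fun i => (i == l) * c i)%N) => [|i _]; last by rewrite /= count_nseq.
  rewrite big_enum/= (bigD1 l)//= eqxx mul1n big1 ?addn0 ?ffunE// => i /negPf ->.
  by rewrite mul0n.
apply: (@le_trans _ _ (multi_partial (fun i => c i) (pgf P V) ones)); last first.
  exact: (@le_bigmax_cond _ _ _ _ c (fun j : {ffun 'I_d -> 'I_k.+1} => (\sum_i j i == k)%N)
    (fun j => multi_partial (fun i => j i) (pgf P V) ones)).
rewrite /multi_partial; apply: le_trans (factorial_moment_le_partial _).
rewrite le_eqVlt; apply/orP; left; apply/eqP; apply: eq_integral => w _.
by rewrite (falling_perm _ (fun l => esym (cs' l))).
Qed.

Lemma factorial_moment_nil : factorial_moment P V [::] = 1%E.
Proof.
rewrite /factorial_moment (eq_integral (cst 1%E)) => [|w _]; last by rewrite falling_nil.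
by rewrite integral_cst//= mul1e probability_setT.
Qed.

Lemma taylor_term0 u : taylor_term P V 0 u = 1.
Proof.
rewrite /taylor_term (big_pred1 [tuple]) => [|t]; last by apply/esym/eqP/tuple0.
by rewrite big_nil mulr1 factorial_moment_nil.
Qed.

Lemma taylor_term1 u : taylor_term P V 1 u = \sum_l mean P V ord0 l * u ord0 l.
Proof.
rewrite /taylor_term sum_tuple_cons; apply: eq_bigr => l _.
rewrite (big_pred1 [tuple]) => [|t]; last by apply/esym/eqP/tuple0.
by rewrite /= big_seq1 mean_factorial_moment.
Qed.

(** A product of [i > 0] numbers of [0, r] is at most [r] when [r <= 1]. *)
Lemma taylor_term_le i u r : (0 < i)%N -> r <= 1 -> (forall l, 0 <= u ord0 l <= r) ->
  0 <= taylor_term P V i u <=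
  (\sum_(s : i.-tuple 'I_d) fine (factorial_moment P V s)) * r.
Proof.
move=> i0 r1 ur; have fm0 s : 0 <= fine (factorial_moment P V s).
  by rewrite fine_ge0// factorial_moment_ge0.
have prod0 (s : seq 'I_d) : 0 <= \prod_(l <- s) u ord0 l.
  by apply: prodr_ge0 => l _; case/andP: (ur l).
apply/andP; split; first by apply: sumr_ge0 => s _; rewrite mulr_ge0.
rewrite mulr_suml; apply: ler_sum => s _; rewrite ler_wpM2l//.
case: s => -[|l s] /= szs; first by move: i0; rewrite -(eqP szs).
have /andP[ul0 ulr] := ur l.
rewrite big_cons (le_trans _ ulr)// ler_piMr//.
apply: prodr_ile1 => m _; have /andP[-> umr] := ur m.
exact: le_trans umr r1.
Qed.

End ImmigrationMoments.

(** * Averages along the weights of the immigration times *)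

Section Weights.
Context (R : realType) (rho : nat -> R).
Hypothesis rho01 : forall n, (0 < n)%N -> 0 <= rho n <= 1.
Hypothesis rho_lt1 : forall n, (0 < n)%N -> rho n < 1.
Hypothesis rho_dvg : \sum_(1 <= j < n.+1) (1 - rho j) @[n --> \oo] --> +oo%R.

(** Equal to [rho_prod rho j n - rho_prod rho j.-1 n], so that sums telescope. *)
Definition weight n j : R := rho_prod rho j n * (1 - rho j).

Lemma weight_ge0 n j : (0 < j)%N -> 0 <= weight n j.
Proof.
move=> j0; have /andP[r0 _] := rho_prod01 rho01 j n.
by rewrite mulr_ge0// subr_ge0 ltW// rho_lt1.
Qed.

Lemma sum_weight n : \sum_(1 <= j < n.+1) weight n j = 1 - rho_prod rho 0 n.
Proof.
rewrite (eq_big_nat _ _ (F2 := fun j => rho_prod rho j n - rho_prod rho j.-1 n)).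
  by rewrite big_add1/= telescope_sumr// rho_prodnn.
move=> [|j]// /andP[_ jn]; rewrite /weight mulrBr mulr1 (rho_prod_split rho (ltnSE jn)).
by rewrite [X in _ - X]mulrC.
Qed.

Lemma sum_weight_le1 n : \sum_(1 <= j < n.+1) weight n j <= 1.
Proof.
by rewrite sum_weight gerBl; case/andP: (rho_prod01 rho01 0 n).
Qed.

(** If [p * (1 + S) <= 1] and [0 <= r <= 1], then [p * r * (1 + S + (1 - r)) <= 1]. The
    divergence of the sum thus forces the product to 0. *)
Lemma rho_prod_le j n : (j <= n)%N ->
  rho_prod rho j n * (1 + \sum_(j.+1 <= s < n.+1) (1 - rho s)) <= 1.
Proof.
elim: n => [|n IHn]; first by rewrite leqn0 => /eqP ->; rewrite /rho_prod !big_geq// mul1r addr0.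
rewrite leq_eqVlt => /predU1P[->|]; first by rewrite /rho_prod !big_geq// mul1r addr0.
rewrite ltnS => jn; rewrite rho_prodS// big_nat_recr//=.
have := IHn jn; set S := \sum_(_ <= _ < _) _ => {}IHn.
have /andP[p0 p1] := rho_prod01 rho01 j n.
have /andP[r0 r1] := rho01 (ltn0Sn n).
have S0 : 0 <= S.
  rewrite /S big_nat_cond sumr_ge0// => s /andP[/andP[js _] _].
  by rewrite subr_ge0; case/andP: (rho01 (leq_ltn_trans (leq0n j) js)).
apply: le_trans IHn; rewrite -mulrA ler_wpM2l//.
rewrite -subr_ge0 (_ : _ - _ = (1 - rho n.+1) * (1 - rho n.+1 + S)); last by ring.
have r1' : 0 <= 1 - rho n.+1 by rewrite subr_ge0.
by rewrite mulr_ge0// addr_ge0.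
Qed.

Lemma rho_prod_cvg0 j : rho_prod rho j n @[n --> \oo] --> (0 : R).
Proof.
apply/cvgrPdist_le => e e0.
pose c := \sum_(1 <= s < j.+1) (1 - rho s).
have /cvgryPge/(_ (e^-1 + c)) H := rho_dvg.
near=> n.
have jn : (j <= n)%N by near: n; exact: nbhs_infty_ge.
have : e^-1 + c <= \sum_(1 <= s < n.+1) (1 - rho s) by near: n.
rewrite (@big_cat_nat _ _ _ j.+1)//= -/c [X in X <= _]addrC lerD2l => Se.
have := rho_prod_le jn; set S := \sum_(j.+1 <= _ < _) _ in Se *.
have /andP[p0 p1] := rho_prod01 rho01 j n.
rewrite sub0r normrN ger0_norm//; set p := rho_prod rho j n in p0 p1 * => pS.
have ei : 0 < e^-1 by rewrite invr_gt0.
have : p * e^-1 <= 1 by apply: le_trans pS; rewrite ler_wpM2l//; lra.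
by rewrite ler_pdivrMr// mul1r.
Unshelve. all: by end_near. Qed.

Lemma sum_weight_cvg1 : \sum_(1 <= j < n.+1) weight n j @[n --> \oo] --> (1 : R).
Proof.
under eq_fun do rewrite sum_weight.
suff : 1 - rho_prod rho 0 n @[n --> \oo] --> (1 - 0 : R) by rewrite subr0.
by apply: cvgB; [exact: cvg_cst|exact: rho_prod_cvg0].
Qed.

(** Toeplitz's lemma: the early weights vanish as [n] grows, and the late terms are
    small on average because the total weight is at most 1. *)
Lemma toeplitz (b : nat -> R) : b n @[n --> \oo] --> 0 ->
  \sum_(1 <= j < n.+1) weight n j * `|b j| @[n --> \oo] --> 0.
Proof.
move=> b0; apply/cvgrPdist_le => e e0.
have e2 : 0 < e / 2 by rewrite divr_gt0.
have /cvgrPdist_le/(_ _ e2)[N _ bN] := b0.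
have head : \sum_(1 <= j < N.+1) weight n j * `|b j| @[n --> \oo] --> 0.
  suff : \sum_(1 <= j < N.+1) weight n j * `|b j| @[n --> \oo] -->
      \sum_(1 <= j < N.+1) (`|b j| * (1 - rho j)) * 0.
    by rewrite big1// => j _; rewrite mulr0.
  apply: cvg_seq_sum => j _; rewrite /weight.
  under eq_fun do rewrite mulrC [X in _ * X]mulrC mulrA.
  exact/cvg_seqMl/rho_prod_cvg0.
have /cvgrPdist_le/(_ _ e2) H := head.
near=> n.
have Nn : (N <= n)%N by near: n; exact: nbhs_infty_ge.
have : `|0 - \sum_(1 <= j < N.+1) weight n j * `|b j| | <= e / 2 by near: n.
have sum_ge0 p q : 0 <= \sum_(p.+1 <= j < q) weight n j * `|b j|.
  rewrite big_nat_cond sumr_ge0// => j /andP[/andP[pj _] _].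
  by rewrite mulr_ge0// weight_ge0// (leq_ltn_trans _ pj).
rewrite !sub0r !normrN !ger0_norm ?sum_ge0// => hN.
rewrite (@big_cat_nat _ _ _ N.+1)//= [leRHS](splitr e) lerD//.
apply: (@le_trans _ _ (\sum_(N.+1 <= j < n.+1) weight n j * (e / 2))).
  rewrite big_nat_cond [leRHS]big_nat_cond ler_sum// => j /andP[/andP[Nj _] _].
  rewrite ler_wpM2l ?weight_ge0 ?(leq_ltn_trans _ Nj)//.
  by have := bN j (ltnW Nj); rewrite /= sub0r normrN.
rewrite -mulr_suml ler_piMl ?(ltW e2)//; apply: le_trans (sum_weight_le1 n).
rewrite [leRHS](@big_cat_nat _ _ _ N.+1)//= lerDr.
rewrite big_nat_cond sumr_ge0// => j /andP[/andP[pj _] _].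
by rewrite weight_ge0.
Unshelve. all: by end_near. Qed.

Lemma toeplitz_dominated (c : nat -> nat -> R) (b : nat -> R) :
  (forall n j, (0 < j)%N -> `|c n j| <= weight n j) -> b n @[n --> \oo] --> 0 ->
  \sum_(1 <= j < n.+1) c n j * b j @[n --> \oo] --> 0.
Proof.
move=> cw b0; apply: cvg_seq_dominated (toeplitz b0) => n.
rewrite (le_trans (ler_norm_sum _ _ _))// big_nat_cond [leRHS]big_nat_cond ler_sum//.
by move=> j /andP[/andP[j0 _] _]; rewrite normrM ler_wpM2r// cw.
Qed.

End Weights.

Section WeightedPowers.
Context (R : realType) (rho : nat -> R).
Hypothesis rho01 : forall n, (0 < n)%N -> 0 <= rho n <= 1.
Hypothesis rho_lt1 : forall n, (0 < n)%N -> rho n < 1.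
Hypothesis rho_cvg : rho n @[n --> \oo] --> (1 : R).
Hypothesis rho_dvg : \sum_(1 <= j < n.+1) (1 - rho j) @[n --> \oo] --> +oo%R.
Hypothesis rho_reg : (1 - rho n) / (1 - rho n.+1) @[n --> \oo] --> (1 : R).

(** Summation by parts: consecutive weights differ by a factor close to 1, so
    that shifting a bounded sequence by one changes its weighted mean little. *)
Lemma weighted_increment_cvg0 (w : nat -> R) : (forall m, 0 <= w m <= 1) ->
  \sum_(1 <= j < n.+1) weight rho n j * (w (n - j).+1 - w (n - j)%N) @[n --> \oo] --> 0.
Proof.
move=> w01; pose b m := 1 - rho m * ((1 - rho m.-1) / (1 - rho m)).
have b0 : b n @[n --> \oo] --> 0.
  rewrite -cvg_shiftS /b /=.
  suff : 1 - rho n.+1 * ((1 - rho n) / (1 - rho n.+1)) @[n --> \oo] --> (1 - 1 * 1 : R).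
    by rewrite mulr1 subrr.
  apply: cvgB; first exact: cvg_cst.
  by apply: cvgM => //; rewrite (cvg_shiftS rho).
have E n : (0 < n)%N ->
    \sum_(1 <= j < n.+1) weight rho n j * (w (n - j).+1 - w (n - j)%N) =
    \sum_(1 <= j < n.+1) (weight rho n j * w (n - j).+1) * b j +
      (rho_prod rho 0 n * (1 - rho 0%N) * w n - (1 - rho n) * w 0%N).
  move=> n0; under eq_bigr do rewrite mulrBr.
  rewrite sumrB.
  have -> : \sum_(1 <= j < n.+1) weight rho n j * w (n - j).+1 * b j =
      \sum_(1 <= j < n.+1) weight rho n j * w (n - j).+1 -
      \sum_(1 <= j < n.+1) weight rho n j.-1 * w (n - j).+1.
    rewrite -sumrB; apply: eq_big_nat => -[|j]// /andP[_ jn].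
    rewrite /b /weight (rho_prod_split rho (ltnSE jn))/=.
    have r1 : 1 - rho j.+1 != 0 by rewrite subr_eq0 gt_eqF// rho_lt1.
    by field.
  have -> : \sum_(1 <= j < n.+1) weight rho n j.-1 * w (n - j).+1 =
      \sum_(0 <= j < n) weight rho n j * w (n - j)%N.
    rewrite big_add1/=; apply: eq_big_nat => j /andP[_ jn].
    by rewrite subnSK.
  rewrite [\sum_(0 <= _ < n) _]big_ltn// !big_nat_recr//= subn0 subnn.
  rewrite /weight rho_prodnn; ring.
suff : \sum_(1 <= j < n.+1) (weight rho n j * w (n - j).+1) * b j +
      (rho_prod rho 0 n * (1 - rho 0%N) * w n - (1 - rho n) * w 0%N)
    @[n --> \oo] --> (0 + (0 - (1 - 1) * w 0%N) : R).
  rewrite subrr mul0r subrr addr0; apply: cvg_trans; apply: near_eq_cvg.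
  by exists 1%N => // n /= n0; rewrite E.
have wn n m : 0 <= w m by case/andP: (w01 m).
apply: cvgD.
  apply: (toeplitz_dominated rho01 rho_lt1 rho_dvg _ b0) => n j j0.
  have w0j := weight_ge0 rho01 rho_lt1 n j0; have /andP[w0 w1] := w01 (n - j).+1.
  by rewrite ger0_norm; [rewrite ler_piMr|exact: mulr_ge0].
apply: cvgB.
  apply: (cvg_seq_dominated (v := fun n => `|1 - rho 0%N| * rho_prod rho 0 n)).
    move=> n; have /andP[w0 w1] := w01 n; have /andP[p0 p1] := rho_prod01 rho01 0 n.
    rewrite !normrM (ger0_norm p0) (ger0_norm w0) [leRHS]mulrC.
    by rewrite ler_piMr// mulr_ge0.
  rewrite -(mulr0 `|1 - rho 0%N|); apply: cvg_seqMl.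
  exact: rho_prod_cvg0.
apply: cvgM; last exact: cvg_cst.
by apply: cvgB => //; exact: cvg_cst.
Qed.

Context (d : nat) (B : 'M[R]_d).
Hypothesis B_sub : substochastic B.

(** The powers of [B] are bounded, so 1 is a semisimple eigenvalue: on a vector
    [w *m (B - 1)] fixed by [B], the orbit of [w] would grow linearly. *)
Lemma fixed_cap_image : (kermx (B - 1%:M) :&: (B - 1%:M))%MS = 0.
Proof.
apply/eqP/rowV0P => v; rewrite sub_capmx => /andP[/sub_kermxP vK /submxP[w vw]].
have vB : v *m B = v.
  by apply/eqP; rewrite -subr_eq0 -{2}[v]mulmx1 -mulmxBr vK.
have wB : w *m B = w + v by rewrite vw mulmxBr mulmx1 addrC subrK.
have wBn n : w *m B ^+ n = w + n%:R *: v.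
  elim: n => [|n IHn]; first by rewrite expr0 mulmx1 scale0r addr0.
  rewrite exprSr [w *m _](mulmxA w (B ^+ n) B) IHn mulmxDl -scalemxAl wB vB.
  by rewrite -addrA -{1}[v]scale1r -scalerDl nat1r.
apply/rowP => i; rewrite [RHS]mxE; apply/eqP/negPn/negP => vi.
pose c := \sum_l `|w ord0 l|.
have bound n : `|v ord0 i| *+ n <= c + c.
  have wc : `|w ord0 i| <= c.
    by rewrite /c (bigD1 i)//= lerDl sumr_ge0.
  have wBc : `|(w *m B ^+ n) ord0 i| <= c.
    rewrite mxE (le_trans (ler_norm_sum _ _ _))// ler_sum// => l _.
    have /andP[b0 b1] := substochastic_entry (substochastic_expr B_sub n) l i.
    by rewrite normrM (ger0_norm b0) ler_piMr.
  have -> : `|v ord0 i| *+ n = `|(w *m B ^+ n) ord0 i - w ord0 i|.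
    by rewrite wBn !mxE addrAC subrr add0r normrM normr_nat mulr_natl.
  by rewrite (le_trans (ler_normB _ _))// lerD.
have v0 : 0 < `|v ord0 i| by rewrite normr_gt0.
have := archi_boundP (divr_ge0 (le_trans (mulrn_wge0 0 (normr_ge0 (v ord0 i))) (bound 0%N)) (ltW v0)).
by rewrite ltr_pdivrMr// mulr_natl ltNge bound.
Qed.

(** Decompose [1 = X *m K + Y *m (B - 1)], where the rows of [K] are fixed by [B].
    The first part is constant along the powers of [B], and the second is handled
    by summation by parts; the limit is [X *m K]. *)
Lemma weighted_powers_cvg : exists A : 'M[R]_d,
  forall i l, \sum_(1 <= j < n.+1) weight rho n j * (B ^+ (n - j)) i l @[n --> \oo] --> A i l.
Proof.
pose N := B - 1%:M; pose K := kermx N.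
have full : (1%:M <= K + N)%MS.
  rewrite sub1mx -col_leq_rank mxrank_disjoint_sum ?fixed_cap_image//.
  by rewrite mxrank_ker subnK// rank_leq_row.
have /sub_addsmxP[[X Y] /= XY] := full.
have KB m : K *m B ^+ m = K.
  have KB1 : K *m B = K.
    by apply/eqP; rewrite -subr_eq0 -{2}[K]mulmx1 -mulmxBr mulmx_ker.
  elim: m => [|m IHm]; first by rewrite expr0 mulmx1.
  by rewrite exprS [K *m _](mulmxA K B (B ^+ m)) KB1.
exists (X *m K) => i l.
have E n j : (B ^+ (n - j)) i l = (X *m K) i l +
    \sum_m Y i m * ((B ^+ (n - j).+1) m l - (B ^+ (n - j)) m l).
  transitivity ((1%:M *m B ^+ (n - j)) i l); first by rewrite mul1mx.
  rewrite XY mulmxDl -mulmxA KB mxE; congr (_ + _).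
  rewrite -mulmxA mxE; apply: eq_bigr => m _.
  by rewrite /N mulmxBl mul1mx exprS !mxE.
have -> : (fun n => \sum_(1 <= j < n.+1) weight rho n j * (B ^+ (n - j)) i l) =
    (fun n => (X *m K) i l * \sum_(1 <= j < n.+1) weight rho n j +
       \sum_m Y i m * \sum_(1 <= j < n.+1)
         weight rho n j * ((B ^+ (n - j).+1) m l - (B ^+ (n - j)) m l)).
  apply/funext => n; under eq_bigr do rewrite E mulrDr.
  rewrite big_split/=; congr (_ + _).
    by rewrite mulr_sumr; apply: eq_bigr => j _; rewrite mulrC.
  under eq_bigr do rewrite mulr_sumr.
  rewrite exchange_big/=; apply: eq_bigr => m _; rewrite mulr_sumr.
  by apply: eq_bigr => j _; rewrite mulrCA.
suff : (fun n => (X *m K) i l * \sum_(1 <= j < n.+1) weight rho n j +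
       \sum_m Y i m * \sum_(1 <= j < n.+1)
         weight rho n j * ((B ^+ (n - j).+1) m l - (B ^+ (n - j)) m l)) n
    @[n --> \oo] --> ((X *m K) i l * 1 + \sum_m Y i m * 0 : R).
  by rewrite mulr1 big1 ?addr0// => m _; rewrite mulr0.
apply: cvgD; first exact/cvg_seqMl/sum_weight_cvg1.
apply: cvg_seq_sum => m _; apply: cvg_seqMl.
apply: (weighted_increment_cvg0 (w := fun p => (B ^+ p) m l)) => p.
exact: substochastic_entry (substochastic_expr B_sub p) m l.
Qed.

End WeightedPowers.

(** * Convergence of the generating functions *)

Section ProductExponential.
Context (R : realType).

Lemma expRN_approx (h : R) : 0 <= h <= 1 -> 0 <= expR (- h) - (1 - h) <= h ^+ 2.
Proof.
move=> /andP[h0 h1]; apply/andP; split; first by rewrite subr_ge0 expR_ge1Dx.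
have h1' : 0 < 1 + h by rewrite ltr_pwDl.
have : expR (- h) <= (1 + h)^-1 by rewrite expRN lef_pV2 ?posrE ?expR_gt0// expR_ge1Dx.
suff : (1 + h)^-1 <= 1 - h + h ^+ 2 by lra.
rewrite -[leLHS]mul1r ler_pdivrMr//.
have : 0 <= h ^+ 3 by rewrite exprn_ge0.
rewrite !exprS expr0 => h3; nra.
Qed.

Lemma prod_expR_approx (I : eqType) (r : seq I) (h : I -> R) :
  (forall i, i \in r -> 0 <= h i <= 1) ->
  `|\prod_(i <- r) (1 - h i) - expR (- \sum_(i <- r) h i)| <= \sum_(i <- r) h i ^+ 2.
Proof.
elim: r => [|i r IHr] h01; first by rewrite !big_nil oppr0 expR0 subrr normr0.
have hr01 j : j \in r -> 0 <= h j <= 1 by move=> jr; apply: h01; rewrite inE jr orbT.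
have {IHr} := IHr hr01.
have /andP[h0 h1] := h01 i (mem_head _ _).
rewrite !big_cons opprD expRD; set p := \prod_(j <- r) _; set S := \sum_(j <- r) h j.
set T := \sum_(j <- r) _ => IHr.
have S0 : 0 <= S by rewrite /S big_seq sumr_ge0// => j /hr01/andP[].
have e1 : expR (- S) <= 1 by rewrite -expR0 ler_expR lerNl oppr0.
have e0 : 0 <= expR (- S) by exact: expR_ge0.
have /andP[d0 d1] : 0 <= expR (- h i) - (1 - h i) <= h i ^+ 2.
  by apply: expRN_approx; rewrite h0.
have -> : (1 - h i) * p - expR (- h i) * expR (- S) =
    (1 - h i) * (p - expR (- S)) - (expR (- h i) - (1 - h i)) * expR (- S) by ring.
rewrite (le_trans (ler_normB _ _))// addrC lerD//.
  by rewrite ger0_norm ?mulr_ge0// (le_trans _ d1)// ler_piMr.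
rewrite normrM ger0_norm ?subr_ge0// (le_trans _ IHr)// ler_piMl//.
by rewrite gerBl.
Qed.

End ProductExponential.

Lemma sume_lty_term (R : realDomainType) (I : eqType) (r : seq I) (F : I -> \bar R) i :
  (forall j, 0 <= F j)%E -> i \in r -> (\sum_(j <- r) F j < +oo)%E -> (F i < +oo)%E.
Proof.
move=> F0 ir; apply: le_lt_trans; rewrite (big_rem i ir)/= leeDl//.
exact: sume_ge0.
Qed.

Section Convergence.
Context (R : realType) (disp : measure_display)
  (Omega : measurableType disp) (P : probability Omega R) (d : nat)
  (eps : nat -> {RV P >-> 'rV[nat]_d}).
Hypothesis eps_mean : forall n, (0 < n)%N -> finite_mean P (eps n).
Context (rho : nat -> R) (B : 'M[R]_d).
Hypothesis B_unit : B \in unitmx.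
Hypothesis B_sub : substochastic B.
Hypothesis rho01 : forall n, (0 < n)%N -> 0 <= rho n <= 1.
Hypothesis rho_lt1 : forall n, (0 < n)%N -> rho n < 1.
Hypothesis rho_cvg : rho n @[n --> \oo] --> (1 : R).
Hypothesis rho_dvg : \sum_(1 <= j < n.+1) (1 - rho j) @[n --> \oo] --> +oo%R.
Context (k : nat).
Hypothesis k_ge2 : (2 <= k)%N.
Hypothesis H_k : (max_partial k (pgf P (eps n)) (const_mx 1)%R * ((1 - rho n)^-1)%R%:E)%E
           @[n --> \oo] --> 0%E.
Context (lambda : 'rV[R]_d).
Hypothesis m_cvg : (1 - rho n)^-1 *: mean P (eps n) @[n --> \oo] --> lambda.
Context (Lambda : forall i : nat, i.-tuple 'I_d -> R).
Hypothesis Lambda_cvg : forall i : nat, (2 <= i < k)%N -> forall t : i.-tuple 'I_d,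
     (\sum_(1 <= j < n.+1) (rho_prod rho j n ^+ i / i`!%:R)%R%:E *
        \sum_(s : i.-tuple 'I_d)
          iter_partial s (pgf P (eps j)) (const_mx 1)%R *
          (\prod_(r < i) (B ^+ (n - j)) (tnth s r) (tnth t r))%R%:E)%E
       @[n --> \oo] --> (Lambda t)%:E.
Context (A : 'M[R]_d).
Hypothesis A_cvg : forall i l,
  \sum_(1 <= j < n.+1) weight rho n j * (B ^+ (n - j)) i l @[n --> \oo] --> A i l.

Let meps n : measurable_fun setT (eps n) := measurable_funPT (eps n).
Let partial j (s : seq 'I_d) := iter_partial s (pgf P (eps j)) (const_mx 1)%R.
Let moment j (s : seq 'I_d) : R := fine (factorial_moment P (eps j) s).

Let Bpow01 m i l : 0 <= (B ^+ m) i l <= 1.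
Proof. exact: substochastic_entry (substochastic_expr B_sub m) i l. Qed.

Let prodB0 m i (s t : i.-tuple 'I_d) : 0 <= \prod_(r < i) (B ^+ m) (tnth s r) (tnth t r).
Proof. by apply: prodr_ge0 => r _; case/andP: (Bpow01 m (tnth s r) (tnth t r)). Qed.

Let coef0 j n i : 0 <= rho_prod rho j n ^+ i / i`!%:R.
Proof. by rewrite divr_ge0 ?exprn_ge0//; case/andP: (rho_prod01 rho01 j n). Qed.

(** The sums whose limits are the numbers [Lambda], with factorial moments in place
    of the possibly infinite derivatives. *)
Definition Lambda_sum i (t : i.-tuple 'I_d) n : R :=
  \sum_(1 <= j < n.+1) rho_prod rho j n ^+ i / i`!%:R *
     \sum_(s : i.-tuple 'I_d) moment j s *
        \prod_(r < i) (B ^+ (n - j)) (tnth s r) (tnth t r).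

(** A row of an invertible matrix is nonzero, so every partial derivative of
    order [i] enters one of the convergent sums with a positive coefficient,
    unless [rho_prod rho j n] vanishes. *)
Lemma partials_finite : exists N, forall n j i (s : i.-tuple 'I_d),
  (N <= n)%N -> (0 < j <= n)%N -> (2 <= i < k)%N -> rho_prod rho j n != 0 ->
  (partial j s < +oo)%E.
Proof.
pose esum i (t : i.-tuple 'I_d) n := 
     (\sum_(1 <= j < n.+1) (rho_prod rho j n ^+ i / i`!%:R)%R%:E *
        \sum_(s : i.-tuple 'I_d) partial j s *
          (\prod_(r < i) (B ^+ (n - j)) (tnth s r) (tnth t r))%R%:E)%E.
have : \forall n \near \oo, forall (i : 'I_k) (t : i.-tuple 'I_d),
    (2 <= i)%N -> (esum i t n < +oo)%E.
  apply: (@filter_forall _ _ (fun (i : 'I_k) n => forall t : i.-tuple 'I_d,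
    (2 <= i)%N -> (esum i t n < +oo)%E)) => i.
  apply: (@filter_forall _ _ (fun (t : i.-tuple 'I_d) n =>
    (2 <= i)%N -> (esum i t n < +oo)%E)) => t.
  have [i2|_] := leqP 2 i; last exact: nearW.
  have ik : (2 <= i < k)%N by rewrite i2 ltn_ord.
  have /fine_cvgP[+ _] := @Lambda_cvg _ ik t.
  apply: filterS => n; rewrite fin_numE => /andP[_ h] _.
  by rewrite ltey.
move=> [N _ fin]; exists N => n j i s Nn /andP[j0 jn] /andP[i2 ik] r0.
have row0 a : exists l, (B ^+ (n - j)) a l != 0.
  have Bn : B ^+ (n - j) \in unitmx.
    elim: (n - j)%N => [|m IHm]; first by rewrite expr0 unitmx1.
    by rewrite exprS unitmx_mul B_unit.
  apply/existsP; apply: contraTT Bn => /existsPn Ba.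
  apply/negP => Bu; have := congr1 (fun M : 'M[R]_d => M a a) (mulmxV Bu).
  rewrite !mxE eqxx big1 => [/esym/eqP|l _]; first by rewrite oner_eq0.
  by have /negPn/eqP -> := Ba l; rewrite mul0r.
pose f a := xchoose (row0 a).
pose t := [tuple f (tnth s r) | r < i].
have part0 j' s' : (0 <= partial j' s')%E by exact: iter_partial_ge0.
have in0 j' (t' s' : i.-tuple 'I_d) : (0 <= partial j' s' *
    (\prod_(r < i) (B ^+ (n - j')) (tnth s' r) (tnth t' r))%R%:E)%E.
  by rewrite mule_ge0// lee_fin.
have sin0 j' : (0 <= \sum_(s' : i.-tuple 'I_d) partial j' s' *
    (\prod_(r < i) (B ^+ (n - j')) (tnth s' r) (tnth t r))%R%:E)%E.
  by apply: sume_ge0.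
have out0 j' : (0 <= (rho_prod rho j' n ^+ i / i`!%:R)%R%:E *
    \sum_(s' : i.-tuple 'I_d) partial j' s' *
    (\prod_(r < i) (B ^+ (n - j')) (tnth s' r) (tnth t r))%R%:E)%E.
  by rewrite mule_ge0// lee_fin.
have jr : j \in index_iota 1 n.+1 by rewrite mem_index_iota ltnS j0.
have fin1 := sume_lty_term out0 jr (fin n Nn (Ordinal ik) t i2).
have c0 : 0 < rho_prod rho j n ^+ i / i`!%:R.
  rewrite divr_gt0 ?ltr0n ?fact_gt0// exprn_gt0// lt_def r0.
  by case/andP: (rho_prod01 rho01 j n).
have fin1' : (\sum_(s' : i.-tuple 'I_d) partial j s' *
    (\prod_(r < i) (B ^+ (n - j)) (tnth s' r) (tnth t r))%R%:E < +oo)%E.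
  by move: fin1; apply: contraTT; rewrite -!leNgt !leye_eq => /eqP ->; rewrite gt0_muley// lte_fin.
have fin2 := sume_lty_term (in0 j t) (mem_index_enum s) fin1'.
move: fin2; apply: contraTT; rewrite -!leNgt !leye_eq => /eqP ->.
rewrite gt0_mulye// lte_fin; apply: prodr_gt0 => r _.
rewrite lt_def tnth_mktuple (xchooseP (row0 (tnth s r)))/=.
by case/andP: (Bpow01 (n - j) (tnth s r) (f (tnth s r))).
Qed.

(** For large [n], a time [j] at which some derivative is infinite satisfies
    [rho_prod rho j n = 0], and both sums give it the coefficient 0. *)
Lemma Lambda_sum_cvg i (t : i.-tuple 'I_d) : (2 <= i < k)%N ->
  Lambda_sum t n @[n --> \oo] --> Lambda t.
Proof.
move=> ik; have /fine_cvg := @Lambda_cvg _ ik t.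
apply: cvg_trans; apply: near_eq_cvg; have [N fin] := partials_finite.
exists N => // n /= Nn; rewrite -[RHS]/(fine (Lambda_sum t n)%:E); congr fine; apply/esym.
rewrite -sumEFin; apply: eq_big_nat => j /andP[j0 jn].
have [r0|r0] := eqVneq (rho_prod rho j n) 0.
  have i0 : i != 0%N by case/andP: ik; case: (i).
  by rewrite r0 expr0n (negPf i0) !mul0r mul0e.
rewrite EFinM -sumEFin; congr (_ * _)%E; apply: eq_bigr => s _.
rewrite EFinM; congr (_ * _)%E; apply/esym/iter_partial_fin => //.
by apply: (fin n) => //; rewrite j0.
Qed.

Lemma low_moment_finite j i (s : i.-tuple 'I_d) : (0 < j)%N -> (i <= 1)%N ->
  (factorial_moment P (eps j) s < +oo)%E.
Proof.
move=> j0; case: i s => [|[|i]] s// _; first by rewrite (tuple0 s) factorial_moment_nil ltry.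
by case: s => -[|l [|]]//= _; apply: finite_mean_moment => //; exact: eps_mean.
Qed.

Let max_moment j := max_partial k (pgf P (eps j)) (const_mx 1)%R.

(** At late times [j] the hypothesis on [Lambda] applies with [n = j], where the
    coefficient [rho_prod rho j j] is 1. *)
Lemma moments_eventually_finite : exists N, forall j, (N <= j)%N -> (0 < j)%N ->
  exists2 c, max_moment j = (c * (1 - rho j))%:E & 
    c = fine (max_moment j * ((1 - rho j)^-1)%R%:E)%E /\
    forall i (s : i.-tuple 'I_d), (i <= k)%N -> (factorial_moment P (eps j) s < +oo)%E.
Proof.
have [N1 fin1] := partials_finite.
have /fine_cvgP[[N2 _ fin2] _] := H_k.
exists (maxn N1 N2) => j; rewrite geq_max => /andP[N1j N2j] j0.
have r1 : 0 < 1 - rho j by rewrite subr_gt0 rho_lt1.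
have := fin2 j N2j; rewrite -/(max_moment j) => finj.
exists (fine (max_moment j * ((1 - rho j)^-1)%R%:E)%E).
  rewrite EFinM fineK// -muleA -EFinM mulVf ?mule1// gt_eqF//.
split=> // i s ik.
have [i1|i2] := leqP i 1; first exact: low_moment_finite.
move: ik; rewrite leq_eqVlt => /predU1P[ik|ik].
  apply: (@le_lt_trans _ _ (max_moment j)).
    rewrite /max_moment; move: s; rewrite ik => s.
    exact: factorial_moment_le_max.
  move: finj; case: (max_moment j) => [c| |]//; rewrite ?ltry// ?ltNyr//.
  by rewrite gt0_mulye// lte_fin invr_gt0.
apply: le_lt_trans (factorial_moment_le_partial _ _ _) _ => //.
by apply: (fin1 j) => //; rewrite ?j0 ?leqnn ?i2// rho_prodnn oner_neq0.
Qed.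

(** At late times the error is bounded by the [k]-th moments, which are
    [o(1 - rho j)]. At the finitely many early times, where higher moments may be
    infinite, [1 - H_j] and the nonconstant terms of the expansion are
    [O(rho_prod rho j n)], which is enough for an average along the weights. *)
Lemma taylor_error : exists2 b : nat -> R, b n @[n --> \oo] --> 0 &
  forall (u : 'rV[R]_d) n j, (forall l, 0 <= u ord0 l <= 1) -> (0 < j)%N ->
  `|rpgf P (eps j) (const_mx 1 - propagate rho B j n u) -
    \sum_(i < k) (-1) ^+ i / i`!%:R * taylor_term P (eps j) i (propagate rho B j n u)| <=
  weight rho n j * `|b j|.
Proof.
have [N fin] := moments_eventually_finite.
pose crude j := (\sum_(s : 1.-tuple 'I_d) moment j s) +
  \sum_(i < k) \sum_(s : i.-tuple 'I_d) moment j s.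
pose beta j := fine (max_moment j * ((1 - rho j)^-1)%R%:E)%E.
pose C : R := #|{: k.-tuple 'I_d}|%:R.
exists (fun j => if (N <= j)%N then C * beta j else crude j / (1 - rho j)).
  have : C * beta n @[n --> \oo] --> C * 0 by apply: cvg_seqMl; exact: fine_cvg H_k.
  rewrite mulr0; apply: cvg_trans; apply: near_eq_cvg; exists N => // n /= Nn.
  by rewrite Nn.
move=> u n j u01 j0.
have r1 : 0 < 1 - rho j by rewrite subr_gt0 rho_lt1.
set th := propagate rho B j n u.
have /andP[p0 p1] := rho_prod01 rho01 j n.
have thp := propagate01 B_sub rho01 j n u01.
have th01 l : 0 <= th ord0 l <= 1.
  by have /andP[-> h] := thp l; exact: le_trans h p1.
have fm0 s : 0 <= moment j s by rewrite fine_ge0// factorial_moment_ge0.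
case: leqP => [Nj|jN].
  have [c maxE [cE finj]] := fin j Nj j0.
  apply: le_trans (taylor_rpgf (meps j) th01 finj) _.
  have k0 : (0 < k)%N by apply: leq_trans k_ge2.
  have /andP[T0 T1] := taylor_term_le P (eps j) k0 p1 thp.
  have kf : 1 <= k`!%:R :> R by rewrite ler1n fact_gt0.
  rewrite (@le_trans _ _ (taylor_term P (eps j) k th))//.
    by rewrite ler_pdivrMr ?(lt_le_trans ltr01)// ler_peMr.
  apply: le_trans T1 _; rewrite -/(beta j) in cE; rewrite -cE.
  apply: (@le_trans _ _ (C * (c * (1 - rho j)) * rho_prod rho j n)).
    rewrite ler_wpM2r// /C mulr_natl -sumr_const; apply: ler_sum => s _.
    rewrite -lee_fin -maxE fineK; first exact: factorial_moment_le_max.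
    by rewrite ge0_fin_numE ?factorial_moment_ge0// finj.
  rewrite /weight (_ : _ * _ = rho_prod rho j n * (1 - rho j) * (C * c)); last by ring.
  by rewrite ler_wpM2l ?ler_norm// mulr_ge0// ltW.
have crude0 : 0 <= crude j.
  by rewrite addr_ge0 ?sumr_ge0// => i _; rewrite sumr_ge0.
rewrite /weight [`|crude j / _|]ger0_norm; last by rewrite divr_ge0// ltW.
rewrite [leRHS](_ : _ = crude j * rho_prod rho j n); last by field; rewrite gt_eqF.
have := taylor_rpgf (meps j) th01 (fun i s => @low_moment_finite j i s j0).
rewrite big_ord1 expr0 fact0 divr1 mul1r taylor_term0 divr1 => T1.
have [k' kE] : exists k', k = k'.+1 by case: (k) k_ge2 => // k' _; exists k'.
have -> : \sum_(i < k) (-1) ^+ i / i`!%:R * taylor_term P (eps j) i th =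
    1 + \sum_(i < k | (0 < i)%N) (-1) ^+ i / i`!%:R * taylor_term P (eps j) i th.
  rewrite kE (bigD1 ord0)//= expr0 fact0 divr1 mul1r taylor_term0; congr (_ + _).
  by apply: eq_bigl => i; rewrite lt0n.
rewrite opprD addrA (le_trans (ler_normB _ _))// /crude mulrDl lerD//.
  rewrite (le_trans T1)//; by have /andP[] := taylor_term_le P (eps j) (ltn0Sn 0) p1 thp.
rewrite (le_trans (ler_norm_sum _ _ _))// mulr_suml [leRHS](bigID (fun i : 'I_k => (0 < i)%N))/=.
rewrite -[leLHS]addr0 lerD//; last first.
  by apply: sumr_ge0 => i _; rewrite mulr_ge0// sumr_ge0.
apply: ler_sum => i i0.
have /andP[t0 t1] := taylor_term_le P (eps j) i0 p1 thp.
apply: le_trans t1; rewrite normrM (ger0_norm t0) ler_piMl//.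
rewrite normrM normrX normrN1 expr1n mul1r ger0_norm// invf_le1 ?ltr0n ?fact_gt0//.
by rewrite ler1n fact_gt0.
Qed.

(** In the variable [y = x - 1]. *)
Definition limit_exponent (y : 'rV[R]_d) : R :=
  (y *m (lambda *m A)^T) ord0 ord0 +
  \sum_(2 <= i < k) \sum_(t : i.-tuple 'I_d) Lambda t * \prod_(r < i) y ord0 (tnth t r).

Lemma propagateE j n (u : 'rV[R]_d) l :
  propagate rho B j n u ord0 l = rho_prod rho j n * \sum_m (B ^+ (n - j)) l m * u ord0 m.
Proof.
rewrite mxE mxE; congr (_ * _); apply: eq_bigr => m _.
by rewrite mxE mulrC.
Qed.

Lemma taylor_term_propagate i (u : 'rV[R]_d) n :
  \sum_(1 <= j < n.+1) (-1) ^+ i / i`!%:R * taylor_term P (eps j) i (propagate rho B j n u) =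
  \sum_(t : i.-tuple 'I_d) Lambda_sum t n * \prod_(r < i) (- u) ord0 (tnth t r).
Proof.
rewrite /Lambda_sum; under [RHS]eq_bigr do rewrite mulr_suml.
rewrite exchange_big/=; apply: eq_bigr => j _.
have prodE (s : i.-tuple 'I_d) : \prod_(l <- s) propagate rho B j n u ord0 l =
    rho_prod rho j n ^+ i * \sum_(t : i.-tuple 'I_d)
      (\prod_(r < i) (B ^+ (n - j)) (tnth s r) (tnth t r)) *
      \prod_(r < i) u ord0 (tnth t r).
  rewrite big_tuple (eq_bigr _ (fun r _ => propagateE _ _ _ _)) big_split/=.
  rewrite prodr_const card_ord prod_sum_tuple; congr (_ * _).
  by apply: eq_bigr => t _; rewrite big_split.
have prodN (t : i.-tuple 'I_d) : \prod_(r < i) (- u) ord0 (tnth t r) =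
    (-1) ^+ i * \prod_(r < i) u ord0 (tnth t r).
  rewrite (eq_bigr (fun r => - u ord0 (tnth t r))) => [|r _]; last by rewrite mxE.
  by rewrite prodrN card_ord.
rewrite /taylor_term.
under [in LHS]eq_bigr do rewrite prodE mulrCA mulr_sumr.
under [RHS]eq_bigr do rewrite prodN mulr_sumr mulr_suml.
rewrite -mulr_sumr exchange_big/= mulr_sumr mulr_sumr; apply: eq_bigr => t _.
rewrite mulr_sumr mulr_sumr; apply: eq_bigr => s _.
rewrite /moment; ring.
Qed.

(** Writing [mean (eps j) = (1 - rho j) * (lambda + b j)] with [b j] tending to 0 turns
    the sum into an average of powers of [B] and an average of a null sequence. *)
Lemma linear_term_cvg (u : 'rV[R]_d) :
  \sum_(1 <= j < n.+1) taylor_term P (eps j) 1 (propagate rho B j n u) @[n --> \oo] -->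
  (u *m (lambda *m A)^T) ord0 ord0.
Proof.
pose b l j := (1 - rho j)^-1 * mean P (eps j) ord0 l - lambda ord0 l.
have b0 l : b l n @[n --> \oo] --> 0.
  have /cvg_mx_entries/(_ ord0 l) := m_cvg.
  under eq_fun do rewrite mxE; move=> ml.
  by rewrite -(subrr (lambda ord0 l)); apply: cvgB => //; exact: cvg_cst.
have E n : \sum_(1 <= j < n.+1) taylor_term P (eps j) 1 (propagate rho B j n u) =
    \sum_l \sum_m (u ord0 m * (
      lambda ord0 l * \sum_(1 <= j < n.+1) weight rho n j * (B ^+ (n - j)) l m +
      \sum_(1 <= j < n.+1) (weight rho n j * (B ^+ (n - j)) l m) * b l j)).
  under [RHS]eq_bigr do under eq_bigr do
    rewrite mulr_sumr -big_split/= mulr_sumr.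
  under [RHS]eq_bigr do rewrite exchange_big/=.
  rewrite [RHS]exchange_big/=; apply: eq_big_nat => j /andP[j0 _].
  rewrite taylor_term1; apply: eq_bigr => l _.
  rewrite propagateE !mulr_sumr; apply: eq_bigr => m _.
  have r1 : 1 - rho j != 0 by rewrite subr_eq0 gt_eqF// rho_lt1.
  by rewrite /b /weight; field.
under eq_fun do rewrite E.
suff : (fun n => \sum_l \sum_m (u ord0 m * (
      lambda ord0 l * \sum_(1 <= j < n.+1) weight rho n j * (B ^+ (n - j)) l m +
      \sum_(1 <= j < n.+1) (weight rho n j * (B ^+ (n - j)) l m) * b l j))) n
    @[n --> \oo] --> \sum_l \sum_m (u ord0 m * (lambda ord0 l * A l m + 0) : R).
  rewrite exchange_big/= [in X in _ -> X]mxE.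
  rewrite [X in _ --> X -> _](eq_bigr (fun m => u ord0 m * (lambda *m A)^T m ord0))//.
  by move=> m _; rewrite -mulr_sumr !mxE; congr (_ * _); apply: eq_bigr => l _; rewrite addr0.
apply: cvg_seq_sum => l _; apply: cvg_seq_sum => m _; apply: cvg_seqMl.
apply: cvgD; first by apply: cvg_seqMl; exact: A_cvg.
apply: (toeplitz_dominated rho01 rho_lt1 rho_dvg _ (b0 l)) => n j j0.
have w0 := weight_ge0 rho01 rho_lt1 n j0; have /andP[B0 B1] := Bpow01 (n - j) l m.
by rewrite normrM (ger0_norm w0) (ger0_norm B0) ler_piMr.
Qed.

Lemma immigration_sum_cvg (u : 'rV[R]_d) : (forall l, 0 <= u ord0 l <= 1) ->
  \sum_(1 <= j < n.+1) (rpgf P (eps j) (const_mx 1 - propagate rho B j n u) - 1)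
    @[n --> \oo] --> limit_exponent (- u).
Proof.
move=> u01; have [b b0 berr] := taylor_error.
pose T j n i := (-1) ^+ i / i`!%:R * taylor_term P (eps j) i (propagate rho B j n u).
pose err j n := rpgf P (eps j) (const_mx 1 - propagate rho B j n u) - \sum_(i < k) T j n i.
have errcvg : \sum_(1 <= j < n.+1) err j n @[n --> \oo] --> 0.
  apply: cvg_seq_dominated (toeplitz rho01 rho_lt1 rho_dvg b0) => n.
  rewrite (le_trans (ler_norm_sum _ _ _))// big_nat_cond [leRHS]big_nat_cond ler_sum// => j.
  by rewrite andbT => /andP[j0 _]; exact: berr.
have E n : \sum_(1 <= j < n.+1) (rpgf P (eps j) (const_mx 1 - propagate rho B j n u) - 1) =
    \sum_(1 <= j < n.+1) err j n +
    (- \sum_(1 <= j < n.+1) taylor_term P (eps j) 1 (propagate rho B j n u) +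
     \sum_(2 <= i < k) \sum_(t : i.-tuple 'I_d)
       Lambda_sum t n * \prod_(r < i) (- u) ord0 (tnth t r)).
  under [\sum_(2 <= i < k) _]eq_bigr do rewrite -taylor_term_propagate.
  rewrite [\sum_(2 <= i < k) _]exchange_big/= -sumrN -!big_split/=; apply: eq_bigr => j _.
  rewrite /err -(big_mkord xpredT (T j n)) big_ltn ?(leq_trans _ k_ge2)// big_ltn//.
  rewrite /T expr0 fact0 divr1 mul1r taylor_term0 expr1 divr1 mulN1r.
  ring.
under eq_fun do rewrite E.
suff : \sum_(1 <= j < n.+1) err j n +
    (- \sum_(1 <= j < n.+1) taylor_term P (eps j) 1 (propagate rho B j n u) +
     \sum_(2 <= i < k) \sum_(t : i.-tuple 'I_d)
       Lambda_sum t n * \prod_(r < i) (- u) ord0 (tnth t r))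
    @[n --> \oo] --> (0 + limit_exponent (- u) : R) by rewrite add0r; apply.
apply: cvgD => //; rewrite /limit_exponent mulNmx [X in X + _]mxE.
apply: cvgD; first by apply: cvgN; exact: linear_term_cvg.
rewrite big_nat_cond; under eq_fun do rewrite big_nat_cond.
apply: cvg_seq_sum => i /andP[ik _]; apply: cvg_seq_sum => t _.
under eq_fun do rewrite mulrC; rewrite mulrC.
by apply: cvg_seqMl; exact: Lambda_sum_cvg.
Qed.

Lemma immigration_defect (u : 'rV[R]_d) n j : (forall l, 0 <= u ord0 l <= 1) -> (0 < j)%N ->
  let h := 1 - rpgf P (eps j) (const_mx 1 - propagate rho B j n u) in
  0 <= h <= (\sum_l mean P (eps j) ord0 l) * rho_prod rho j n /\ h <= 1.
Proof.
move=> u01 j0 h; have /andP[p0 p1] := rho_prod01 rho01 j n.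
have thp := propagate01 B_sub rho01 j n u01.
have th01 l : 0 <= propagate rho B j n u ord0 l <= 1.
  by have /andP[-> hl] := thp l; exact: le_trans hl p1.
have /andP[r0 r1] : 0 <= rpgf P (eps j) (const_mx 1 - propagate rho B j n u) <= 1.
  by apply: rpgf01 => //; exact: unit_cube_complement.
split; last by rewrite gerBl.
rewrite subr_ge0 r1/=.
have := taylor_rpgf (meps j) th01 (fun i s => @low_moment_finite j i s j0).
rewrite big_ord1 expr0 fact0 divr1 mul1r taylor_term0 divr1 distrC => T1.
apply: le_trans (ler_norm _) (le_trans T1 _).
rewrite taylor_term1 mulr_suml ler_sum// => l _.
rewrite ler_wpM2l//; last by case/andP: (thp l).
by rewrite mean_factorial_moment fine_ge0// factorial_moment_ge0.
Qed.

(** The square of [1 - H_j (1 - u_(j,n))] is at most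
    [(mean (eps j) * rho_prod rho j n) ^+ 2], of order [weight rho n j * (1 - rho j)]. *)
Lemma immigration_product_cvg (u : 'rV[R]_d) : (forall l, 0 <= u ord0 l <= 1) ->
  \prod_(1 <= j < n.+1) rpgf P (eps j) (const_mx 1 - propagate rho B j n u)
    @[n --> \oo] --> expR (limit_exponent (- u)).
Proof.
move=> u01; pose h j n := 1 - rpgf P (eps j) (const_mx 1 - propagate rho B j n u).
pose kappa j := \sum_l (1 - rho j)^-1 * mean P (eps j) ord0 l.
have kcvg : kappa n @[n --> \oo] --> \sum_l lambda ord0 l.
  apply: cvg_seq_sum => l _; have /cvg_mx_entries/(_ ord0 l) := m_cvg.
  by under eq_fun do rewrite mxE.
have b0 : kappa n ^+ 2 * (1 - rho n) @[n --> \oo] --> 0.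
  suff : kappa n ^+ 2 * (1 - rho n) @[n --> \oo] --> ((\sum_l lambda ord0 l) ^+ 2 * (1 - 1) : R).
    by rewrite subrr mulr0.
  by apply: cvgM; [exact: cvg_seqX|apply: cvgB => //; exact: cvg_cst].
have sq0 : \sum_(1 <= j < n.+1) h j n ^+ 2 @[n --> \oo] --> 0.
  apply: cvg_seq_dominated (toeplitz rho01 rho_lt1 rho_dvg b0) => n.
  rewrite ger0_norm; last by apply: sumr_ge0 => j _; rewrite sqr_ge0.
  rewrite big_nat_cond [leRHS]big_nat_cond ler_sum// => j.
  rewrite andbT => /andP[j0 _]; have [/andP[h0 h1] _] := immigration_defect n u01 j0.
  have r1 : 0 < 1 - rho j by rewrite subr_gt0 rho_lt1.
  have /andP[p0 p1] := rho_prod01 rho01 j n.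
  have kE : \sum_l mean P (eps j) ord0 l = kappa j * (1 - rho j).
    rewrite /kappa mulr_suml; apply: eq_bigr => l _.
    by rewrite mulrAC mulVf ?mul1r// gt_eqF.
  rewrite ger0_norm; last exact: mulr_ge0 (sqr_ge0 _) (ltW r1).
  apply: (@le_trans _ _ ((kappa j * (1 - rho j) * rho_prod rho j n) ^+ 2)).
    by rewrite -kE lerXn2r ?nnegrE// (le_trans h0).
  rewrite /weight (_ : _ ^+ 2 = rho_prod rho j n * (1 - rho j) *
    (kappa j ^+ 2 * (1 - rho j)) * rho_prod rho j n); last by ring.
  rewrite ler_piMr//; apply: mulr_ge0; first exact: mulr_ge0 p0 (ltW r1).
  exact: mulr_ge0 (sqr_ge0 _) (ltW r1).
have diff0 : (\prod_(1 <= j < n.+1) (1 - h j n) - expR (- \sum_(1 <= j < n.+1) h j n))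
    @[n --> \oo] --> 0.
  apply: cvg_seq_dominated sq0 => n; apply: prod_expR_approx => j.
  rewrite mem_index_iota => /andP[j0 _].
  by have [/andP[h0 _] h1] := immigration_defect n u01 j0; rewrite h0.
have expc : expR (- \sum_(1 <= j < n.+1) h j n) @[n --> \oo] --> expR (limit_exponent (- u)).
  apply: continuous_cvg; first exact: continuous_expR.
  have := immigration_sum_cvg u01; apply: cvg_trans; apply: near_eq_cvg.
  apply: nearW => n; rewrite -sumrN; apply: eq_bigr => j _.
  by rewrite /h opprB.
have prodc : (\prod_(1 <= j < n.+1) (1 - h j n) - expR (- \sum_(1 <= j < n.+1) h j n)) +
    expR (- \sum_(1 <= j < n.+1) h j n) @[n --> \oo] --> (0 + expR (limit_exponent (- u)) : R).
  exact: cvgD.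
rewrite add0r in prodc; apply: cvg_trans prodc; apply: near_eq_cvg.
apply: nearW => n; rewrite subrK; apply: eq_bigr => j _.
by rewrite /h opprB addrC subrK.
Qed.

Lemma limit_exponent_tight e : 0 < e -> exists2 z : R, 0 < z < 1 &
  1 - e < expR (limit_exponent (const_mx z - const_mx 1)).
Proof.
move=> e0; pose z n : R := 1 - harmonic n / 2.
have hcvg : z n - 1 @[n --> \oo] --> 0.
  have : - 2^-1 * harmonic n @[n --> \oo] --> (- 2^-1 * 0 : R).
    by apply: cvg_seqMl; exact: cvg_harmonic.
  rewrite mulr0; apply: cvg_trans; apply: near_eq_cvg; apply: nearW => n.
  by rewrite /z; ring.
have : expR (limit_exponent (const_mx (z n) - const_mx 1)) @[n --> \oo] --> expR (0 : R).
  apply: continuous_cvg; first exact: continuous_expR.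
  rewrite /limit_exponent.
  have lim0 : 0 * (\sum_m (lambda *m A) ord0 m) +
      \sum_(2 <= i < k) \sum_(t : i.-tuple 'I_d) Lambda t * 0 ^+ i = 0 :> R.
    rewrite mul0r add0r big_nat_cond; apply: big1 => i /andP[/andP[i2 _] _].
    by apply: big1 => t _; rewrite expr0n gtn_eqF ?mulr0// (ltn_trans _ i2).
  have zcvg : (z n - 1) * (\sum_m (lambda *m A) ord0 m) +
      \sum_(2 <= i < k) \sum_(t : i.-tuple 'I_d) Lambda t * (z n - 1) ^+ i
    @[n --> \oo] --> (0 * (\sum_m (lambda *m A) ord0 m) +
      \sum_(2 <= i < k) \sum_(t : i.-tuple 'I_d) Lambda t * 0 ^+ i : R).
    apply: cvgD; first by apply: cvgM => //; exact: cvg_cst.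
    apply: cvg_seq_sum => i _; apply: cvg_seq_sum => t _; apply: cvg_seqMl.
    exact: cvg_seqX.
  rewrite lim0 in zcvg; apply: cvg_trans zcvg; apply: near_eq_cvg; apply: nearW => n.
  congr (_ + _).
    by rewrite mxE mulr_sumr; apply: eq_bigr => m _; rewrite !mxE.
  apply: eq_bigr => i _; apply: eq_bigr => t _; congr (_ * _).
  by rewrite (eq_bigr (fun=> z n - 1)) ?prodr_const ?card_ord// => r _; rewrite !mxE.
rewrite expR0 => /cvgrPdist_lt/(_ _ e0)[N _ /(_ N (leqnn N))] /ltr_normlW zN.
have h0 : 0 < harmonic N :> R by exact: harmonic_gt0.
have h1 : harmonic N <= 1 :> R by rewrite /harmonic/= invf_le1 ?ler1n ?ltr0n.
exists (z N); last by rewrite ltrBlDr -ltrBlDl.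
by rewrite /z; apply/andP; split; lra.
Qed.

End Convergence.

(** * The continuity theorem for generating functions *)

Section BoundedExpectation.
Context (disp : measure_display) (Omega : measurableType disp) (R : realType).
Variable P : probability Omega R.
Context (d : nat) (V : Omega -> 'rV[nat]_d).
Hypothesis mV : measurable_fun setT V.
Implicit Types f g : 'rV[nat]_d -> R.

Definition bounded_vec f := exists M, forall v, `|f v| <= M.

Definition expect f : R := \int[P]_w f (V w).

Lemma bounded_vecD f g : bounded_vec f -> bounded_vec g -> bounded_vec (fun v => f v + g v).
Proof.
move=> [M fM] [N gN]; exists (M + N) => v.
by rewrite (le_trans (ler_normD _ _))// lerD.
Qed.

Lemma bounded_vecZ c f : bounded_vec f -> bounded_vec (fun v => c * f v).
Proof. by move=> [M fM]; exists (`|c| * M) => v; rewrite normrM ler_wpM2l. Qed.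

Lemma bounded_vec_cst c : bounded_vec (fun=> c).
Proof. by exists `|c|. Qed.

Lemma bounded_vec_sum (I : Type) (r : seq I) (F : I -> 'rV[nat]_d -> R) :
  (forall i, bounded_vec (F i)) -> bounded_vec (fun v => \sum_(i <- r) F i v).
Proof.
move=> bF; elim: r => [|i r [M IHr]].
  by exists 0 => v; rewrite big_nil normr0.
have [N FN] := bF i; exists (N + M) => v.
by rewrite big_cons (le_trans (ler_normD _ _))// lerD.
Qed.

Lemma bounded_vec_integrable f : bounded_vec f ->
  P.-integrable setT (EFin \o (fun w => f (V w))).
Proof.
move=> [M fM]; apply: measurable_bounded_integrable => //.
- by apply: (le_lt_trans (probability_le1 P measurableT)); rewrite ltry.
- exact: measurable_funT_vec.
- by exists M; split; rewrite ?num_real// => y My w _ /=; apply: (le_trans (fM _)); exact: ltW.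
Qed.

Lemma expect_fin f : bounded_vec f -> (\int[P]_w (f (V w))%:E = (expect f)%:E)%E.
Proof.
move=> bf; rewrite /expect /Rintegral fineK//.
by apply: integrable_fin_num => //; exact: bounded_vec_integrable.
Qed.

Lemma expectD f g : bounded_vec f -> bounded_vec g ->
  expect (fun v => f v + g v) = expect f + expect g.
Proof. by move=> bf bg; rewrite /expect RintegralD//; exact: bounded_vec_integrable. Qed.

Lemma expectZ c f : bounded_vec f -> expect (fun v => c * f v) = c * expect f.
Proof. by move=> bf; rewrite /expect RintegralZl//; exact: bounded_vec_integrable. Qed.

Lemma expect_cst c : expect (fun=> c) = c.
Proof. by rewrite /expect Rintegral_cst//= probability_setT mulr1. Qed.

Lemma expect_sum (I : Type) (r : seq I) (F : I -> 'rV[nat]_d -> R) :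
  (forall i, bounded_vec (F i)) ->
  expect (fun v => \sum_(i <- r) F i v) = \sum_(i <- r) expect (F i).
Proof.
move=> bF; elim: r => [|i r IHr].
  by rewrite big_nil -[RHS]expect_cst; apply: eq_Rintegral => w _; rewrite big_nil.
rewrite big_cons -IHr -expectD//; last exact: bounded_vec_sum.
by apply: eq_Rintegral => w _; rewrite big_cons.
Qed.

Lemma expect_le f g : bounded_vec f -> bounded_vec g -> (forall v, f v <= g v) ->
  expect f <= expect g.
Proof.
move=> bf bg fg; apply: le_Rintegral => //; exact: bounded_vec_integrable.
Qed.

Lemma expect_norm_le f g : bounded_vec f -> bounded_vec g ->
  (forall v, `|f v| <= g v) -> `|expect f| <= expect g.
Proof.
move=> bf bg fg; rewrite ler_norml; apply/andP; split.
  rewrite -mulN1r -expectZ//; apply: expect_le => //; first exact: bounded_vecZ.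
  by move=> v; rewrite mulN1r lerNl (le_trans _ (fg v))// ler_normr lexx orbT.
by apply: expect_le => // v; rewrite (le_trans _ (fg v))// ler_norm.
Qed.

Lemma expect_dist_le f g c : bounded_vec f -> bounded_vec g ->
  (forall v, `|f v - g v| <= c) -> `|expect f - expect g| <= c.
Proof.
move=> bf bg fg; have -> : expect f - expect g = expect (fun v => f v + -1 * g v).
  by rewrite expectD ?expectZ ?mulN1r//; exact: bounded_vecZ.
rewrite -[leRHS]expect_cst; apply: expect_norm_le.
- by apply: bounded_vecD => //; exact: bounded_vecZ.
- exact: bounded_vec_cst.
- by move=> v; rewrite mulN1r.
Qed.

Lemma rpgf_expect (x : 'rV[R]_d) : rpgf P V x = expect (monomial x).
Proof. by rewrite /rpgf pgfE. Qed.

Lemma bounded_monomial (x : 'rV[R]_d) : (forall l, 0 <= x ord0 l <= 1) ->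
  bounded_vec (monomial x).
Proof.
move=> x01; exists 1 => v; have /andP[m0 m1] := monomial01 v x01.
by rewrite ger0_norm.
Qed.

Definition at_code m (v : 'rV[nat]_d) : R := (pickle v == m)%:R.

Lemma bounded_at_code m : bounded_vec (at_code m).
Proof. by exists 1 => v; rewrite /at_code; case: eqP; rewrite ?normr1 ?normr0. Qed.

Lemma sum_at_code N (v : 'rV[nat]_d) (h : nat -> R) :
  \sum_(m < N) h m * at_code m v = if (pickle v < N)%N then h (pickle v) else 0.
Proof.
case: ltnP => vN.
  rewrite (bigD1 (Ordinal vN))//= /at_code eqxx mulr1 big1 ?addr0// => i iv.
  by rewrite eq_sym (negPf (contraNneq _ iv)) ?mulr0// => iE; apply/eqP/val_inj.
rewrite big1// => i _; rewrite /at_code gtn_eqF ?mulr0//.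
exact: leq_trans vN.
Qed.

(** The mass of the vectors with code at least [N] controls the truncation error
    for all functions bounded by [M] at once. *)
Lemma expect_head_le f M N : (forall v, `|f v| <= M) ->
  `|expect f - \sum_(m < N) f (decode d m) * expect (at_code m)| <=
  M * (1 - \sum_(m < N) expect (at_code m)).
Proof.
move=> fM; have bf : bounded_vec f by exists M.
have bh c : bounded_vec (fun v => \sum_(m < N) c m * at_code m v).
  by apply: bounded_vec_sum => m; apply: bounded_vecZ; exact: bounded_at_code.
have hE c : \sum_(m < N) c m * expect (at_code m) =
    expect (fun v => \sum_(m < N) c m * at_code m v).
  rewrite expect_sum; last by move=> m; apply: bounded_vecZ; exact: bounded_at_code.
  by apply: eq_bigr => m _; rewrite expectZ//; exact: bounded_at_code.
rewrite -[X in 1 - X](eq_bigr _ (fun m _ => mul1r _)) (hE (fun=> 1)) (hE (f \o decode d \o val)).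
have -> : M * (1 - expect (fun v => \sum_(m < N) 1 * at_code m v)) =
    expect (fun v => M * (1 + -1 * \sum_(m < N) 1 * at_code m v)).
  rewrite expectZ; last by apply: bounded_vecD; [exact: bounded_vec_cst|exact: bounded_vecZ].
  by rewrite expectD ?expect_cst ?expectZ ?mulN1r//; [exact: bounded_vec_cst|exact: bounded_vecZ].
have -> : forall a, expect f - expect a = expect f + -1 * expect a by move=> a; rewrite mulN1r.
rewrite -expectZ// -expectD//; last exact: bounded_vecZ.
apply: expect_norm_le.
- by apply: bounded_vecD => //; exact: bounded_vecZ.
- apply: bounded_vecZ; apply: bounded_vecD; first exact: bounded_vec_cst.
  exact: bounded_vecZ.
move=> v; rewrite (sum_at_code N v (f \o decode d)) (sum_at_code N v (fun=> 1)).
case: ifP => _ /=; first by rewrite pickle_decode !mulN1r !subrr normr0 mulr0.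
by rewrite !mulr0 !addr0 mulr1.
Qed.

End BoundedExpectation.

Section PointMasses.
Context (R : realType) (d : nat) (q : nat -> {nonneg R}).

(** The normalization is an argument so that the probability structure below can
    be inferred from the term. *)
Definition point_masses_of (_ : (\sum_(0 <= m <oo) (q m)%:num%:E = 1 :> \bar R)%E) :
    set 'rV[nat]_d -> \bar R :=
  mseries (fun m => mscale (q m) (dirac (decode d m))) 0.

Hypothesis q1 : (\sum_(0 <= m <oo) (q m)%:num%:E = 1 :> \bar R)%E.

HB.instance Definition _ := Measure.on (point_masses_of q1).

Lemma point_masses_setT : point_masses_of q1 setT = 1%E.
Proof.
rewrite /point_masses_of /mseries -[RHS]q1; apply: eq_eseriesr => m _.
transitivity ((q m)%:num%:E * \d_(decode d m) [set: 'rV[nat]_d])%E => //.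
by rewrite diracT mule1.
Qed.

HB.instance Definition _ := Measure_isProbability.Build _ _ _
  (point_masses_of q1) point_masses_setT.

Lemma point_masses_expect (f : 'rV[nat]_d -> R) : (forall v, 0 <= f v) ->
  (\int[point_masses_of q1]_v (f v)%:E = \sum_(0 <= m <oo) ((q m)%:num * f (decode d m))%:E)%E.
Proof.
move=> f0; have mf D : measurable_fun D (EFin \o f).
  by apply/measurable_EFinP; move=> _ Y _; exact: I.
have f0' v : setT v -> (0 <= (f v)%:E)%E by move=> _; rewrite lee_fin.
rewrite /point_masses_of ge0_integral_measure_series//.
apply: eq_eseriesr => m _; rewrite ge0_integral_mscale//.
by rewrite integral_dirac// diracT mul1e EFinM.
Qed.

End PointMasses.

Section ContinuityTheorem.
Context (disp : measure_display) (Omega : measurableType disp) (R : realType).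
Variable P : probability Omega R.
Context (d : nat) (X : nat -> Omega -> 'rV[nat]_d).
Hypothesis mX : forall n, measurable_fun setT (X n).
Implicit Types f g : 'rV[nat]_d -> R.

Definition expect_converges f := bounded_vec f /\ cvgn (fun n => expect P (X n) f).

Lemma expect_convergesD f g : expect_converges f -> expect_converges g ->
  expect_converges (fun v => f v + g v).
Proof.
move=> [bf cf] [bg cg]; split; first exact: bounded_vecD.
rewrite (_ : (fun n => _) = (fun n => expect P (X n) f) + (fun n => expect P (X n) g)).
  exact: is_cvgD.
by apply/funext => n; rewrite expectD.
Qed.

Lemma expect_convergesZ c f : expect_converges f -> expect_converges (fun v => c * f v).
Proof.
move=> [bf cf]; split; first exact: bounded_vecZ.
rewrite (_ : (fun n => _) = (fun n => c * expect P (X n) f)).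
  by apply/cvg_ex; exists (c * lim (expect P (X n) f @[n --> \oo])); apply: cvg_seqMl.
by apply/funext => n; rewrite expectZ.
Qed.

Lemma expect_converges_sum (I : Type) (r : seq I) (F : I -> 'rV[nat]_d -> R) :
  (forall i, expect_converges (F i)) -> expect_converges (fun v => \sum_(i <- r) F i v).
Proof.
move=> cF; elim: r => [|i r IHr].
  rewrite (_ : (fun v => _) = (fun=> 0)); last by apply/funext => v; rewrite big_nil.
  split; first exact: bounded_vec_cst.
  rewrite (_ : (fun n => _) = (fun=> 0)); first exact: is_cvg_cst.
  by apply/funext => n; rewrite expect_cst.
rewrite (_ : (fun v => _) = (fun v => F i v + \sum_(j <- r) F j v)).
  exact: expect_convergesD.
by apply/funext => v; rewrite big_cons.
Qed.

Lemma expect_converges_approx f :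
  (forall e, 0 < e -> exists2 g, expect_converges g & forall v, `|f v - g v| <= e) ->
  expect_converges f.
Proof.
move=> fg; have bf : bounded_vec f.
  have [g [[M gM] _] fgv] := fg 1 ltr01; exists (1 + M) => v.
  by rewrite -[f v](subrK (g v)) (le_trans (ler_normD _ _))// lerD.
split=> //; apply: cvg_uniform_approx => e e0; have [g [bg cg] fgv] := fg e e0.
by exists (fun n => expect P (X n) g) => // n; exact: expect_dist_le.
Qed.

(** The coefficient of [z ^+ k] is the limit as [z] tends to 0, uniformly on the
    vectors, of a difference quotient that involves the previous ones. *)
Lemma expect_converges_coord (w : 'rV[nat]_d -> R) l : bounded_vec w ->
  (forall z, 0 < z <= 1 -> expect_converges (fun v => w v * z ^+ v ord0 l)) ->
  forall k, expect_converges (fun v => w v * (v ord0 l == k)%:R).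
Proof.
move=> [M wM] cw k; have [n kn] := ubnP k; elim: n k kn => // n IHn k kn.
have M0 : 0 <= M by apply: le_trans (wM 0).
apply: expect_converges_approx => e e0.
pose z := Num.min 1 (e / (M + 1)).
have M1 : 0 < M + 1 by rewrite ltr_wpDl.
have z0 : 0 < z by rewrite lt_min ltr01 divr_gt0.
have z1 : z <= 1 by rewrite ge_min lexx.
have zM : M * z <= e.
  rewrite (@le_trans _ _ ((M + 1) * (e / (M + 1))))//; last by rewrite mulrC divfK// gt_eqF.
  by rewrite ler_pM// ?(ltW z0)// ?lerDl// ge_min lexx orbT.
exists (fun v => z ^- k * (w v * z ^+ v ord0 l +
   -1 * \sum_(i < k) z ^+ i * (w v * (v ord0 l == i)%:R))).
  apply: expect_convergesZ; apply: expect_convergesD; first by apply: cw; rewrite z0.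
  apply: expect_convergesZ; apply: expect_converges_sum => i; apply: expect_convergesZ.
  by apply: IHn; rewrite (leq_trans (ltn_ord i)).
move=> v; set a := v ord0 l.
case: (ltngtP a k) => [ak|ka|->].
- rewrite (bigD1 (Ordinal ak))//= eqxx big1 => [|i ia].
    by rewrite !mulr0 mulr1 addr0 mulN1r (mulrC (w v)) subrr mulr0 subrr normr0 ltW.
  rewrite (_ : (a == i) = false) ?mulr0//.
  by apply: contraNF ia => /eqP ai; apply/eqP/val_inj.
- rewrite big1 => [|i _]; last by rewrite gtn_eqF ?mulr0// (ltn_trans (ltn_ord i)).
  rewrite mulr0 mulr0 addr0 sub0r normrN mulrCA [X in w v * X]mulrC -expfB//.
  rewrite normrM (le_trans _ zM)// ler_pM//.
  rewrite ger0_norm ?exprn_ge0// ?(ltW z0)//.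
  rewrite -(subnK (_ : 0 < a - k)%N) ?subn_gt0// exprD expr1 ler_piMl ?(ltW z0)//.
  by rewrite exprn_ile1// ltW.
- rewrite big1 => [|i _]; last by rewrite gtn_eqF ?mulr0.
  rewrite mulr0 mulr1 addr0 mulrCA mulVf ?mulr1 ?subrr ?normr0 ?ltW//.
  by rewrite expf_neq0// gt_eqF.
Qed.

Context (G : 'rV[R]_d -> R).
Hypothesis pgf_cvg : forall x : 'rV[R]_d, (forall l, 0 <= x ord0 l <= 1) ->
  rpgf P (X n) x @[n --> \oo] --> G x.

(** One after the other, the powers [x l ^+ v l] are replaced by indicators. *)
Lemma expect_converges_mixed (s : seq 'I_d) (a : 'rV[nat]_d) (x : 'rV[R]_d) : uniq s ->
  (forall l, 0 <= x ord0 l <= 1) ->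
  expect_converges (fun v => \prod_l
    (if l \in s then (v ord0 l == a ord0 l)%:R else x ord0 l ^+ v ord0 l)).
Proof.
elim: s x => [|l s IHs] x /= => [_ x01|/andP[ls us] x01].
  split; first exact: bounded_monomial.
  have := pgf_cvg x01; under eq_fun do rewrite rpgf_expect.
  by move=> ?; apply/cvg_ex; exists (G x).
pose w (v : 'rV[nat]_d) : R := \prod_(m | m != l)
  (if m \in s then (v ord0 m == a ord0 m)%:R else x ord0 m ^+ v ord0 m).
rewrite (_ : (fun v => _) = (fun v => w v * (v ord0 l == a ord0 l)%:R)); last first.
  apply/funext => v; rewrite (bigD1 l)//= inE eqxx/= mulrC; congr (_ * _).
  by apply: eq_bigr => m /negPf ml; rewrite inE ml.
apply: expect_converges_coord.
  exists 1 => v; rewrite ger0_norm; last first.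
    apply: prodr_ge0 => m _; case: ifP => _ //.
    by have /andP[xm _] := x01 m; rewrite exprn_ge0.
  apply: prodr_ile1 => m _; case: ifP => _; first by case: (_ == _); rewrite /= ?lexx ?ler01.
  by have /andP[x0 x1] := x01 m; rewrite exprn_ge0//= exprn_ile1.
move=> z /andP[z0 z1].
pose y : 'rV[R]_d := \row_m (if m == l then z else x ord0 m).
have := IHs y us; rewrite (_ : (fun v => _) = (fun v => w v * z ^+ v ord0 l)).
  by apply=> m; rewrite mxE; case: ifP => // _; rewrite (ltW z0).
apply/funext => v; rewrite (bigD1 l)//= (negPf ls) mxE eqxx mulrC; congr (_ * _).
by apply: eq_bigr => m /negPf ml; rewrite mxE ml.
Qed.

Lemma expect_converges_at_code m : expect_converges (at_code R m).
Proof.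
have [dm|dm] := eqVneq (pickle (decode d m)) m; last first.
  rewrite (_ : at_code R m = (fun v : 'rV[nat]_d => 0 * monomial (const_mx 1 : 'rV[R]_d) v)).
    apply: expect_convergesZ; have x01 (l : 'I_d) : 0 <= (const_mx 1 : 'rV[R]_d) ord0 l <= 1.
      by rewrite mxE lexx ler01.
    split; first exact: bounded_monomial.
    have := pgf_cvg x01; under eq_fun do rewrite rpgf_expect.
    by move=> ?; apply/cvg_ex; exists (G (const_mx 1)).
  apply/funext => v; rewrite mul0r /at_code; case: eqP => // vm.
  by move: dm; rewrite -vm pickle_decode eqxx.
have := @expect_converges_mixed (enum 'I_d) (decode d m) (const_mx 1) (enum_uniq _).
rewrite (_ : (fun v => _) = at_code R m).
  by apply=> l; rewrite mxE lexx ler01.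
apply/funext => v; rewrite /at_code -[in RHS]dm (inj_eq (pcan_inj pickleK)).
case: eqP => [->|vd].
  by rewrite big1// => l _; rewrite mem_enum/= eqxx.
have /existsP[l vl] : [exists l, v ord0 l != decode d m ord0 l].
  by apply: contra_notT vd => /existsPn vd; apply/rowP => l; apply/eqP/negPn.
by rewrite (bigD1 l)//= mem_enum/= (negPf vl) mul0r.
Qed.

End ContinuityTheorem.

Section LimitLaw.
Context (disp : measure_display) (Omega : measurableType disp) (R : realType).
Variable P : probability Omega R.
Context (d : nat) (X : nat -> Omega -> 'rV[nat]_d).
Hypothesis mX : forall n, measurable_fun setT (X n).
Context (G : 'rV[R]_d -> R).
Hypothesis pgf_cvg : forall x : 'rV[R]_d, (forall l, 0 <= x ord0 l <= 1) ->
  rpgf P (X n) x @[n --> \oo] --> G x.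
Hypothesis G_tight : forall e, 0 < e -> exists2 z, 0 < z < 1 & 1 - e < G (const_mx z).

Definition limit_mass m : R := lim (expect P (X n) (at_code R m) @[n --> \oo]).

Lemma limit_mass_cvg m : expect P (X n) (@at_code R d m) @[n --> \oo] --> limit_mass m.
Proof. by case: (expect_converges_at_code mX pgf_cvg m). Qed.

Lemma limit_mass_head_cvg N :
  \sum_(m < N) expect P (X n) (@at_code R d m) @[n --> \oo] --> \sum_(m < N) limit_mass m.
Proof. by apply: cvg_seq_sum => m _; exact: limit_mass_cvg. Qed.

Lemma limit_mass_ge0 m : 0 <= limit_mass m.
Proof.
apply: (@cvgr_to_ge _ _ _ R _ _ _ (@limit_mass_cvg m)); apply: nearW => n.
by apply: Rintegral_ge0 => w _; rewrite /at_code.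
Qed.

Lemma expect_head n N : \sum_(m < N) expect P (X n) (@at_code R d m) =
  expect P (X n) (fun v => \sum_(m < N) 1 * at_code R m v).
Proof.
rewrite expect_sum//; last by move=> m; apply: bounded_vecZ; exact: bounded_at_code.
by apply: eq_bigr => m _; rewrite expectZ ?mul1r//; exact: bounded_at_code.
Qed.

Lemma limit_mass_head_le1 N : \sum_(m < N) limit_mass m <= 1.
Proof.
apply: (@cvgr_to_le _ _ _ R _ _ _ (@limit_mass_head_cvg N)); apply: nearW => n.
rewrite expect_head -[leRHS](expect_cst P (X n)); apply: expect_le => //.
- by apply: bounded_vec_sum => m; apply: bounded_vecZ; exact: bounded_at_code.
- exact: bounded_vec_cst.
- by move=> v; rewrite (sum_at_code N v (fun=> 1)); case: ifP.
Qed.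

Lemma pickle_bounded K : exists N, forall v : 'rV[nat]_d,
  (\sum_l v ord0 l < K)%N -> (pickle v < N)%N.
Proof.
exists (\max_(f : {ffun 'I_d -> 'I_K}) pickle (\row_l (f l : nat) : 'rV[nat]_d)).+1 => v vK.
have vl l : (v ord0 l < K)%N.
  by apply: leq_ltn_trans vK; rewrite (bigD1 l)//= leq_addr.
pose f := [ffun l => Ordinal (vl l)].
rewrite ltnS (_ : v = \row_l (f l : nat)).
  exact: (leq_bigmax (F := fun f : {ffun 'I_d -> 'I_K} =>
    pickle (\row_l (f l : nat) : 'rV[nat]_d)) f).
by apply/rowP => l; rewrite mxE ffunE.
Qed.

Lemma monomial_const (z : R) (v : 'rV[nat]_d) :
  monomial (const_mx z) v = z ^+ (\sum_l v ord0 l).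
Proof. by rewrite -prodrXr; apply: eq_bigr => l _; rewrite mxE. Qed.

(** Outside the finite set of vectors with [\sum_l v l < K] one has
    [z ^+ (\sum_l v l) <= z ^+ K], so a generating function close to 1 at [z < 1]
    leaves little mass there. *)
Lemma limit_mass_tight e : 0 < e -> exists N, 1 - e <= \sum_(m < N) limit_mass m.
Proof.
move=> e0; have e2 : 0 < e / 2 by rewrite divr_gt0.
have [z /andP[z0 z1] Gz] := G_tight e2.
have [K zK] : exists K, z ^+ K <= e / 2.
  have : z ^+ n @[n --> \oo] --> 0 by apply: cvg_expr; rewrite ger0_norm// ltW.
  move=> /cvgrPdist_le/(_ _ e2)[K _ /(_ K (leqnn K))]; rewrite sub0r normrN.
  by rewrite ger0_norm ?exprn_ge0 ?(ltW z0)// => zK; exists K.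
have [N pN] := pickle_bounded K; exists N.
have z01 (l : 'I_d) : 0 <= (const_mx z : 'rV[R]_d) ord0 l <= 1 by rewrite mxE (ltW z0) (ltW z1).
have GzK : G (const_mx z) - z ^+ K <= \sum_(m < N) limit_mass m.
  apply: (@ler_cvg_to _ _ _ _ (fun n => rpgf P (X n) (const_mx z) - z ^+ K) _ _ _ _
    (@limit_mass_head_cvg N)).
    by apply: cvgB; [exact: pgf_cvg|exact: cvg_cst].
  apply: nearW => n; rewrite expect_head rpgf_expect lerBlDr.
  rewrite -[z ^+ K](expect_cst P (X n)) -expectD//; last 2 first.
  - by apply: bounded_vec_sum => m; apply: bounded_vecZ; exact: bounded_at_code.
  - exact: bounded_vec_cst.
  apply: expect_le => //; first exact: bounded_monomial.
    apply: bounded_vecD; last exact: bounded_vec_cst.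
    by apply: bounded_vec_sum => m; apply: bounded_vecZ; exact: bounded_at_code.
  move=> v; rewrite (sum_at_code N v (fun=> 1)); case: ltnP => vN.
    have /andP[_ m1] := monomial01 v z01.
    by rewrite (le_trans m1)// lerDl exprn_ge0// ltW.
  rewrite add0r monomial_const; have vK : (K <= \sum_l v ord0 l)%N.
    by rewrite leqNgt; apply/negP => /pN; rewrite ltnNge vN.
  by rewrite -(subnK vK) exprD ler_piMl ?exprn_ge0 ?exprn_ile1 ?(ltW z0) ?(ltW z1).
by apply: le_trans GzK; lra.
Qed.

Definition limit_mass_nng m : {nonneg R} := NngNum (limit_mass_ge0 m).

Lemma limit_mass_sum1 : (\sum_(0 <= m <oo) (limit_mass_nng m)%:num%:E = 1 :> \bar R)%E.
Proof.
have headE N : (\sum_(0 <= m < N) (limit_mass_nng m)%:num%:E =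
    (\sum_(m < N) limit_mass m)%:E)%E.
  by rewrite big_mkord sumEFin.
apply/eqP; rewrite eq_le; apply/andP; split.
  apply: lime_le; first by apply: is_cvg_nneseries => m _ _; rewrite lee_fin.
  by apply: nearW => N; rewrite headE lee_fin limit_mass_head_le1.
apply/lee_addgt0Pr => e e0; have [N eN] := limit_mass_tight e0.
rewrite -leeBlDr//; apply: (@le_trans _ _ (\sum_(0 <= m < N) (limit_mass_nng m)%:num%:E)%E).
  by rewrite headE -EFinB lee_fin.
by apply: nneseries_lim_ge => m _ _; rewrite lee_fin.
Qed.

Let Q := @point_masses_of R d _ limit_mass_sum1.

Lemma limit_law_at_code m : expect Q id (@at_code R d m) = limit_mass m.
Proof.
rewrite /expect /Rintegral point_masses_expect; last by move=> v; rewrite /at_code.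
rewrite (eq_eseriesr (g := fun j => ((limit_mass j)%:E * (j == m)%:R%:E)%E)).
  by rewrite nneseries_single// lee_fin limit_mass_ge0.
move=> j _; rewrite EFinM/=.
have [jj|jj] := eqVneq (pickle (decode d j)) j; first by rewrite /at_code jj.
suff -> : limit_mass j = 0 by rewrite !mul0e.
apply/cvg_lim => //; rewrite (_ : (fun n => _) = (fun=> 0)); first exact: cvg_cst.
apply/funext => n; rewrite -(expect_cst P (X n) 0); apply: eq_Rintegral => w _.
rewrite /at_code; case: eqP => // vj.
by move: jj; rewrite -vj pickle_decode eqxx.
Qed.

(** Up to the tails, which are small uniformly in [n], both expectations are finite
    combinations of point masses. *)
Lemma limit_law_expect f : bounded_vec f ->
  expect P (X n) f @[n --> \oo] --> expect Q id f.
Proof.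
move=> [M fM]; have M0 : 0 <= M by apply: le_trans (fM 0).
have mid : measurable_fun setT (id : 'rV[nat]_d -> 'rV[nat]_d) by exact: measurable_id.
apply/cvgrPdist_le => e e0.
pose e' := e / (4 * (M + 1)).
have M1 : 0 < M + 1 by rewrite ltr_wpDl.
have e'0 : 0 < e' by rewrite divr_gt0// mulr_gt0.
have Me' : M * e' <= e / 4.
  have -> : M * e' = e / 4 * (M / (M + 1)) by rewrite /e'; field; rewrite gt_eqF.
  by rewrite ler_piMr ?divr_ge0 ?(ltW e0)// ler_pdivrMr// mul1r lerDl.
have [N eN] := limit_mass_tight e'0.
have headf : \sum_(m < N) f (decode d m) * expect P (X n) (@at_code R d m) @[n --> \oo] -->
    \sum_(m < N) f (decode d m) * limit_mass m.
  by apply: cvg_seq_sum => m _; apply: cvg_seqMl; exact: limit_mass_cvg.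
have e4 : 0 < e / 4 by rewrite divr_gt0.
have /cvgrPdist_le/(_ _ e4) H1 := headf.
have /cvgrPdist_le/(_ _ e'0) H2 := @limit_mass_head_cvg N.
near=> n.
have H1n : `|\sum_(m < N) f (decode d m) * limit_mass m -
   \sum_(m < N) f (decode d m) * expect P (X n) (@at_code R d m)| <= e / 4.
  by near: n; exact: H1.
have H2n : `|\sum_(m < N) limit_mass m - \sum_(m < N) expect P (X n) (@at_code R d m)| <= e'.
  by near: n; exact: H2.
have hX := expect_head_le P (mX n) N fM.
have hQ := expect_head_le Q mid N fM.
have hQf : \sum_(m < N) f (decode d m) * expect Q id (@at_code R d m) =
    \sum_(m < N) f (decode d m) * limit_mass m.
  by apply: eq_bigr => m _; rewrite limit_law_at_code.
have hQ1 : \sum_(m < N) expect Q id (@at_code R d m) = \sum_(m < N) limit_mass m.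
  by apply: eq_bigr => m _; rewrite limit_law_at_code.
rewrite hQf hQ1 in hQ; move: hX hQ H1n H2n eN.
set SX := \sum_(m < N) expect P _ _; set S := \sum_(m < N) limit_mass m.
set AX := \sum_(m < N) f _ * expect P _ _; set A := \sum_(m < N) f _ * limit_mass m.
move=> hX hQ hA /ler_normlP[_ hS] eN.
have hX' : M * (1 - SX) <= M * e' + M * e'.
  by rewrite -mulrDr ler_wpM2l//; lra.
have hQ' : M * (1 - S) <= M * e' by rewrite ler_wpM2l//; lra.
have -> : expect Q id f - expect P (X n) f =
    (expect Q id f - A) + (A - AX) + (AX - expect P (X n) f) by ring.
rewrite (le_trans (ler_normD _ _))// (le_trans (lerD (ler_normD _ _) (lexx _)))//.
move: hX; rewrite distrC => hX; lra.
Unshelve. all: by end_near. Qed.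

End LimitLaw.

(** Point masses are integrals of indicators, which are uniform limits of
    combinations of monomials; tightness makes their limits a probability. *)
Theorem continuity_theorem (disp : measure_display) (Omega : measurableType disp)
  (R : realType) (P : probability Omega R) (d : nat) (X : nat -> Omega -> 'rV[nat]_d)
  (G : 'rV[R]_d -> R) :
  (forall n, measurable_fun setT (X n)) ->
  (forall x : 'rV[R]_d, (forall l, 0 <= x ord0 l <= 1) ->
     rpgf P (X n) x @[n --> \oo] --> G x) ->
  (forall e, 0 < e -> exists2 z, 0 < z < 1 & 1 - e < G (const_mx z)) ->
  exists Q : probability 'rV[nat]_d R, forall f : 'rV[nat]_d -> R, bounded_vec f ->
    expect P (X n) f @[n --> \oo] --> expect Q id f.
Proof.
move=> mX pgf_cvg G_tight.
exists (point_masses_of (limit_mass_sum1 mX pgf_cvg G_tight)) => f.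
exact: limit_law_expect.
Qed.

(** * The limit theorem *)

HB.instance Definition _ d := isMeasurableFun.Build _ _ 'rV[nat]_d 'rV[nat]_d
  (@idfun 'rV[nat]_d) (@measurable_id _ _ _).

Theorem theorem5 (R : realType) (disp : measure_display)
  (Omega : measurableType disp) (P : probability Omega R)
  (d : nat) (d_gt0 : (0 < d)%N)
  (xi : nat -> nat -> 'I_d -> {RV P >-> 'rV[nat]_d})
  (eps : nat -> {RV P >-> 'rV[nat]_d})
  (X : nat -> Omega -> 'rV[nat]_d)
  (gwiX : is_gwi xi eps X)
  (bernX : bernoulli_offspring xi)
  (rho : nat -> R) (B : 'M[R]_d)
  (mean_rho : forall n, (0 < n)%N -> offspring_mean_mx xi n = rho n *: B)
  (B_unit : B \in unitmx) (B_sub : substochastic B)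
  (rho_lt1 : forall n, (0 < n)%N -> rho n < 1)
  (rho_cvg : rho n @[n --> \oo] --> (1 : R))
  (rho_dvg : \sum_(1 <= j < n.+1) (1 - rho j) @[n --> \oo] --> +oo%R)
  (rho_reg : (1 - rho n) / (1 - rho n.+1) @[n --> \oo] --> (1 : R))
  (k : nat) (k_ge2 : (2 <= k)%N)
  (H_k : (max_partial k (pgf P (eps n)) (const_mx 1)%R * ((1 - rho n)^-1)%R%:E)%E
           @[n --> \oo] --> 0%E)
  (lambda : 'rV[R]_d)
  (m_cvg : (1 - rho n)^-1 *: mean P (eps n) @[n --> \oo] --> lambda)
  (Lambda : forall i : nat, i.-tuple 'I_d -> R)
  (Lambda_cvg : forall i : nat, (2 <= i < k)%N -> forall t : i.-tuple 'I_d,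
     (\sum_(1 <= j < n.+1) (rho_prod rho j n ^+ i / i`!%:R)%R%:E *
        \sum_(s : i.-tuple 'I_d)
          iter_partial s (pgf P (eps j)) (const_mx 1)%R *
          (\prod_(r < i) (B ^+ (n - j)) (tnth s r) (tnth t r))%R%:E)%E
       @[n --> \oo] --> (Lambda i t)%:E) :
  exists A : 'M[R]_d,
    (\sum_(1 <= j < n.+1) (rho_prod rho j n * (1 - rho j)) *: B ^+ (n - j)
       @[n --> \oo] --> A) /\
    exists (disp' : measure_display) (Omega' : measurableType disp')
      (P' : probability Omega' R) (Y : {RV P' >-> 'rV[nat]_d}),
      (forall x : 'rV[R]_d, (forall l, 0 <= x ord0 l <= 1) ->
         pgf P' Y x =
         (expR (((x - const_mx 1) *m (lambda *m A)^T) ord0 ord0 +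
            \sum_(2 <= i < k) \sum_(t : i.-tuple 'I_d)
              Lambda i t * \prod_(r < i) (x ord0 (tnth t r) - 1)))%:E) /\
      cvg_in_distribution P (fun n w => real_vec R (X n w))
                          P' (fun w => real_vec R (Y w)).
Proof.
have rho01 n : (0 < n)%N -> 0 <= rho n <= 1.
  by move=> n0; rewrite (mean_ratio_ge0 mean_rho B_sub d_gt0 B_unit n0) ltW// rho_lt1.
have [A A_cvg] := weighted_powers_cvg rho01 rho_lt1 rho_cvg rho_dvg rho_reg B_sub.
exists A; split.
  apply/cvg_mx_entries => i l; have := A_cvg i l.
  apply: cvg_trans; apply: near_eq_cvg; apply: nearW => n.
  by rewrite summxE; apply: eq_bigr => j _; rewrite mxE.
have eps_mean n : (0 < n)%N -> finite_mean P (eps n) by exact: gwi_immigration_mean gwiX n.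
pose G x : R := expR (limit_exponent k lambda Lambda A (x - const_mx 1)).
have pgf_cvg (x : 'rV[R]_d) : (forall l, 0 <= x ord0 l <= 1) ->
    rpgf P (X n) x @[n --> \oo] --> G x.
  move=> x01; have u01 := unit_cube_complement x01.
  have := immigration_product_cvg eps_mean B_unit B_sub rho01 rho_lt1 rho_cvg rho_dvg
    k_ge2 H_k m_cvg Lambda_cvg A_cvg u01.
  rewrite opprB; apply: cvg_trans; apply: near_eq_cvg; apply: nearW => n.
  by rewrite -(rpgf_gwi gwiX bernX mean_rho B_sub rho01 n u01) opprB addrC subrK.
have [Q XQ] := continuity_theorem (measurable_gwi gwiX) pgf_cvg
  (@limit_exponent_tight _ _ k lambda Lambda A).
exists default_measure_display, 'rV[nat]_d, Q, idfun; split=> [x x01|f fc [M fM]].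
  rewrite (rpgfE Q (@measurable_id _ _ _) x01) rpgf_expect; congr (_%:E).
  have HQ : rpgf P (X n) x @[n --> \oo] --> expect Q idfun (monomial x).
    by under eq_fun do rewrite rpgf_expect; exact/XQ/bounded_monomial.
  rewrite -(cvg_lim (@Rhausdorff R) HQ).
  rewrite (cvg_lim (@Rhausdorff R) (pgf_cvg x x01)); congr (expR (_ + _)).
  apply: eq_bigr => i _; apply: eq_bigr => t _; congr (_ * _).
  by apply: eq_bigr => r _; rewrite !mxE.
have bf : bounded_vec (fun v => f (real_vec R v)) by exists M => v.
have EE (disp0 : measure_display) (T0 : measurableType disp0) (P0 : probability T0 R)
    (V : T0 -> 'rV[nat]_d) : measurable_fun setT V ->
    'E_P0[f \o (fun w => real_vec R (V w))]%E = (expect P0 V (fun v => f (real_vec R v)))%:E.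
  by move=> mV; rewrite unlock -expect_fin.
rewrite EE; last exact: measurable_id.
under eq_fun do rewrite (EE _ _ _ _ (measurable_gwi gwiX _)).
apply: cvg_EFin; first exact: nearW.
exact: XQ bf.
Qed.
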